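(* Let $0<a<1$. Assume that $E[\zeta^{3}]<\infty$ and that there are constants $A>0$ and $1<\alpha<2$ with $\overline F(x)\sim A x^{-\alpha}$ as $x\to\infty$. Then, as $K\to\infty$, $$\psi_{\wedge}(aK,K)\sim \frac{1}{m_1\mu}\,\overline F_I(aK)+\frac{1}{m_2\mu}\,\overline F_I(K)-H(aK,K)\sim J(aK,K),$$ $$\psi_{\vee}(aK,K)\sim \psi_{\times}(aK,K)\sim H(aK,K).$$
   Context: Let $(\zeta_i)_{i\ge1}$ be i.i.d. nonnegative random variables (inter-arrival times, generic copy $\zeta$) with mean $E[\zeta]=1/\lambda\in(0,\infty)$, and let $(\sigma_i)_{i\ge1}$ be i.i.d. nonnegative random variables (claims, generic copy $\sigma$) with distribution function $F$ and mean $E[\sigma]=1/\mu\in(0,\infty)$; the two sequences are independent. Let $N_t=\max\{n\ge0:\zeta_1+\dots+\zeta_n\le t\}$ be the associated renewal process and $S_t=\sum_{i=1}^{N_t}\sigma_i$. Fix constants $p_1>p_2>\rho:=\lambda/\mu=E[\sigma]/E[\zeta]$, and set $m_i=p_iE[\zeta]-E[\sigma]>0$ for $i=1,2$. For $x_1,x_2>0$ let $b_i(t)=x_i+p_it$ ($i=1,2$) and define $$\psi_{\wedge}(x_1,x_2)=P(\exists t\ge0: S_t>\min\{b_1(t),b_2(t)\}),$$ $$\psi_{\vee}(x_1,x_2)=P(\exists t\ge0: S_t>\max\{b_1(t),b_2(t)\}),$$ $$\psi_{\times}(x_1,x_2)=P(\exists t\ge0,\,u\ge0: S_t>b_1(t),\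 S_u>b_2(u)).$$ Write $\overline F=1-F$. The integrated tail distribution is $F_I(x)=\mu\int_0^x\overline F(y)\,dy$, with $\overline F_I=1-F_I$. Define $$H(aK,K)=\int_0^\infty\overline F\big(\max\{aK+m_1t,\,K+m_2t\}\big)\,dt,$$ $$J(aK,K)=\int_0^\infty\overline F\big(\min\{aK+m_1t,\,K+m_2t\}\big)\,dt.$$ Here $f(K)\sim g(K)$ means $f(K)/g(K)\to1$ as $K\to\infty$. *)

(* Defs.v *)
From HB Require Import structures.
From mathcomp Require Import all_boot all_order all_algebra.
From mathcomp Require Import all_classical all_reals all_analysis.
Set Implicit Arguments.
Unset Strict Implicit.
Unset Printing Implicit Defensive.
Import Order.TTheory GRing.Theory Num.Theory.
Import numFieldNormedType.Exports.
Local Open Scope classical_set_scope.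
Local Open Scope ring_scope.

Definition identically_distributed (d : measure_display) (T : measurableType d)
    (R : realType) (P : probability T R) (X : nat -> T -> R) : Prop :=
  forall (i j : nat) (B : set R), measurable B ->
    P (X i @^-1` B) = P (X j @^-1` B).

Definition mutually_independent (d : measure_display) (T : measurableType d)
    (R : realType) (P : probability T R) (X : nat -> T -> R) : Prop :=
  forall (s : seq nat) (B : nat -> set R), uniq s ->
    (forall i, measurable (B i)) ->
    P (\big[setI/setT]_(i <- s) (X i @^-1` B i)) =
    (\prod_(i <- s) P (X i @^-1` B i))%E.

Definition iid (d : measure_display) (T : measurableType d)
    (R : realType) (P : probability T R) (X : nat -> T -> R) : Prop :=
  mutually_independent P X /\ identically_distributed P X.

Definition generated_salgebra (d : measure_display) (T : measurableType d)
    (R : realType) (X : nat -> T -> R) : set (set T) :=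
  <<s [set A | exists (i : nat) (B : set R),
                 measurable B /\ A = X i @^-1` B] >>.

Definition independent_sequences (d : measure_display) (T : measurableType d)
    (R : realType) (P : probability T R) (X Y : nat -> T -> R) : Prop :=
  forall A B : set T, generated_salgebra X A -> generated_salgebra Y B ->
    P (A `&` B) = (P A * P B)%E.

(* Sequences are indexed from 0: [zeta i] and [sigma i] are the (i+1)-st
   inter-arrival time and claim. *)
Definition arrival_time (T : Type) (R : realType) (zeta : nat -> T -> R)
    (n : nat) (w : T) : R := \sum_(i < n) zeta i w.

(* N_t, the largest n with zeta_1 + ... + zeta_n <= t. When there is no largest
   one (a null event for i.i.d. nonnegative zeta with positive mean, if t >= 0)
   the value is 0. *)
Definition renewal_count (T : Type) (R : realType) (zeta : nat -> T -> R)
    (t : R) (w : T) : nat :=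
  xget 0%N [set n | arrival_time zeta n w <= t /\
    forall k : nat, arrival_time zeta k w <= t -> (k <= n)%N].

Definition total_claims (T : Type) (R : realType) (zeta sigma : nat -> T -> R)
    (t : R) (w : T) : R := \sum_(i < renewal_count zeta t w) sigma i w.

Definition psi_and (d : measure_display) (T : measurableType d)
    (R : realType) (P : probability T R) (zeta sigma : nat -> T -> R)
    (p1 p2 x1 x2 : R) : R :=
  fine (P [set w | exists2 t : R, 0 <= t &
    Num.min (x1 + p1 * t) (x2 + p2 * t) < total_claims zeta sigma t w]).

Definition psi_or (d : measure_display) (T : measurableType d)
    (R : realType) (P : probability T R) (zeta sigma : nat -> T -> R)
    (p1 p2 x1 x2 : R) : R :=
  fine (P [set w | exists2 t : R, 0 <= t &
    Num.max (x1 + p1 * t) (x2 + p2 * t) < total_claims zeta sigma t w]).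

Definition psi_times (d : measure_display) (T : measurableType d)
    (R : realType) (P : probability T R) (zeta sigma : nat -> T -> R)
    (p1 p2 x1 x2 : R) : R :=
  fine (P [set w | exists t u : R, [/\ 0 <= t, 0 <= u,
    x1 + p1 * t < total_claims zeta sigma t w &
    x2 + p2 * u < total_claims zeta sigma u w]]).

Definition tail (d : measure_display) (T : measurableType d)
    (R : realType) (P : probability T R) (X : {RV P >-> R}) (x : R) : R :=
  1 - fine (cdf X x).

Definition integrated_tail (R : realType) (mu : R) (Fbar : R -> R) (x : R) : R :=
  mu * \int[lebesgue_measure]_(y in `[0, x]) Fbar y.

Definition H_integral (R : realType) (Fbar : R -> R) (m1 m2 x1 x2 : R) : R :=
  \int[lebesgue_measure]_(t in `[0, +oo[)
    Fbar (Num.max (x1 + m1 * t) (x2 + m2 * t)).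

Definition J_integral (R : realType) (Fbar : R -> R) (m1 m2 x1 x2 : R) : R :=
  \int[lebesgue_measure]_(t in `[0, +oo[)
    Fbar (Num.min (x1 + m1 * t) (x2 + m2 * t)).

Definition mean_drift (d : measure_display) (T : measurableType d)
    (R : realType) (P : probability T R) (zeta sigma : T -> R) (p : R) : R :=
  p * fine 'E_P[zeta] - fine 'E_P[sigma].

Definition asymp_equiv (R : realType) (f g : R -> R) : Prop :=
  f K / g K @[K --> +oo] --> (1 : R).

(* Main.v *)
Require Import Defs.
From mathcomp Require Import all_boot all_order all_algebra.
From mathcomp Require Import all_classical all_reals all_analysis.
From mathcomp Require Import measurable_realfun ring lra.

(** Why the theorem holds. One big claim causes ruin. Ruin can be read at the
    arrival epochs, and after [t] arrivals the capital of a company is about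
    [x + m * t], with [x = a * K] or [x = K] and [m = p * (1 / lambda) - 1 / mu]. A
    single claim [sigma i] that exceeds the minimum of the two drifted lines at
    [i] ruins one of the companies; one that exceeds their maximum ruins
    both, and at the same time. Summing the tail of the claims over [i] gives
    the integral [J] for the minimum and [H] for the maximum, both of order
    [K ^ (1 - alpha)].

    Everything else must be shown to have probability [o (K ^ (1 - alpha))]
    ([bad_small]). The arrival times stay within [eta * (n + K)] of their means
    except with probability [O (1 / K)], by the Hajek-Renyi inequality
    ([hajek_renyi]). Two claims of index [i] and size above [dl * (i + K)] occur
    with probability [O (K ^ (2 - 2 * alpha))]. The decisive point is that
    [1 < alpha < 2]: the claims truncated at [dl * (i + K)] have second moments
    [O ((dl * (i + K)) ^ (2 - alpha))] ([truncate_second_moment]), so that the same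
    inequality bounds the probability that they leave their means by
    [eta * (n + K)] by a constant times [dl ^ (2 - alpha) * K ^ (1 - alpha)], where
    the factor [dl ^ (2 - alpha)] is as small as desired.

    Outside these events a crossing forces a claim close to the line crossed
    ([large_jump_of_crossing]), which gives the upper bounds
    ([one_jump_upper], [ruin_upper]); as the large claim is unique, ruin of both
    companies at different times also needs a claim above the maximum of
    the lines. For the lower bounds ([one_jump_lower], [ruin_lower]) the claim
    [sigma i] is independent of the claims before it and of the arrival times, which
    are typical with probability close to 1; the union bound over [i] loses only
    the square of its value. Factors close to 1 in the argument of the tail are
    harmless by regular variation ([tail_scale_up], [tail_scale_down]).

    Finally the two terms in [1 - F_I] are the tail integrals along the two lines,
    whose sum is [H + J] ([min_max_integrals]); the first asymptotic expression is
    thus equal to [J]. *)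

Import Order.TTheory GRing.Theory Num.Theory.
Import numFieldNormedType.Exports.
Local Open Scope classical_set_scope.
Local Open Scope ring_scope.
Set Implicit Arguments.
Unset Strict Implicit.
Unset Printing Implicit Defensive.

(** * Probabilities as real numbers *)

Section real_probability.
Context (d : measure_display) (T : measurableType d) (R : realType).
Variable P : probability T R.

Definition pr (A : set T) : R := fine (P A).

Lemma prE A : measurable A -> P A = (pr A)%:E.
Proof. by move=> mA; rewrite /pr fineK// fin_num_measure. Qed.

Lemma pr_ge0 A : 0 <= pr A.
Proof. exact: fine_ge0. Qed.

Lemma pr_le A B : measurable A -> measurable B -> A `<=` B -> pr A <= pr B.
Proof.
move=> mA mB AB; rewrite -lee_fin -!prE//.
by apply: le_measure => //; rewrite inE.
Qed.

Lemma pr_le1 A : measurable A -> pr A <= 1.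
Proof. by move=> mA; rewrite -lee_fin -prE// probability_le1. Qed.

Lemma pr_setC A : measurable A -> pr (~` A) = 1 - pr A.
Proof.
move=> mA; have := probability_setC P mA.
rewrite !prE ?measurableC//; last exact: measurableC.
by rewrite -EFinB => -[].
Qed.

Lemma pr_set0 : pr set0 = 0.
Proof. by rewrite /pr measure0. Qed.

Lemma pr_setU A B : measurable A -> measurable B ->
  pr (A `|` B) = pr A + pr B - pr (A `&` B).
Proof.
move=> mA mB; apply/EFin_inj; rewrite EFinB EFinD -!prE//; last 2 first.
- exact: measurableI.
- exact: measurableU.
by rewrite measureUfinr// ltey_eq fin_num_measure.
Qed.

Lemma pr_setD A B : measurable A -> measurable B -> B `<=` A ->
  pr (A `\` B) = pr A - pr B.
Proof.
move=> mA mB BA; rewrite /pr measureD ?ltey_eq ?fin_num_measure//.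
by rewrite (setIidr BA) fineB// fin_num_measure.
Qed.

Lemma pr_setU_le A B : measurable A -> measurable B ->
  pr (A `|` B) <= pr A + pr B.
Proof. by move=> mA mB; rewrite pr_setU// gerBl pr_ge0. Qed.

Lemma pr_bigcup_le (A : nat -> set T) (c : R) : (forall n, measurable (A n)) ->
  (forall N, \sum_(n < N) pr (A n) <= c) -> pr (\bigcup_n A n) <= c.
Proof.
move=> mA Ac; rewrite -lee_fin -prE; last exact: bigcupT_measurable.
apply: (@le_trans _ _ (\sum_(0 <= n <oo) P (A n))%E).
  by apply: measure_sigma_subadditive => //; exact: bigcupT_measurable.
apply: lime_le; first exact: is_cvg_nneseries.
apply: nearW => N; rewrite big_mkord.
have -> : (\sum_(i < N) P (A i))%E = (\sum_(i < N) (pr (A i))%:E)%E.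
  by apply: eq_bigr => i _; rewrite prE.
by rewrite sumEFin lee_fin.
Qed.

Lemma pr_bigcup_nd (A : nat -> set T) (c : R) : (forall n, measurable (A n)) ->
  (forall m n, (m <= n)%N -> A m `<=` A n) ->
  (forall n, pr (A n) <= c) -> pr (\bigcup_n A n) <= c.
Proof.
move=> mA ndA Ac; rewrite -lee_fin -prE; last exact: bigcupT_measurable.
have := @nondecreasing_cvg_mu _ _ _ P A mA (bigcupT_measurable _ mA).
have ndA' : nondecreasing_seq A by move=> m n /ndA/subsetPset.
move=> /(_ ndA') cA; rewrite -(cvg_lim _ cA)//; apply: lime_le.
  by apply/cvg_ex; exists (P (\bigcup_n A n)).
by apply: nearW => n /=; rewrite prE// lee_fin.
Qed.

Lemma pr_bigsetU_le (A : nat -> set T) n : (forall i, measurable (A i)) ->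
  pr (\big[setU/set0]_(i < n) A i) <= \sum_(i < n) pr (A i).
Proof.
move=> mA; elim: n => [|n IH]; first by rewrite !big_ord0 pr_set0.
rewrite !big_ord_recr/=; apply: (@le_trans _ _ (pr (\big[setU/set0]_(i < n) A i) + pr (A n))).
  by apply: pr_setU_le => //; exact: bigsetU_measurable.
by rewrite lerD2r.
Qed.

(** Each new event overlaps the union of the previous ones with probability at
    most [s * pr (A n)], so for rare pairwise independent events the union bound
    is sharp up to the factor [1 - s]. *)
Lemma pr_bigcup_ge (A : nat -> set T) (N : nat) : (forall n, measurable (A n)) ->
  (forall i j, (i < j)%N -> pr (A i `&` A j) = pr (A i) * pr (A j)) ->
  let s := \sum_(n < N) pr (A n) in s - s ^+ 2 <= pr (\big[setU/set0]_(n < N) A n).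
Proof.
move=> mA iA /=.
have mU n : measurable (\big[setU/set0]_(i < n) A i).
  by apply: bigsetU_measurable.
have cross n : pr (\big[setU/set0]_(i < n) A i `&` A n) <=
    (\sum_(i < n) pr (A i)) * pr (A n).
  have : forall m, (m <= n)%N -> pr (\big[setU/set0]_(i < m) A i `&` A n) <=
    (\sum_(i < m) pr (A i)) * pr (A n).
    elim=> [|m IH] mn; first by rewrite !big_ord0 set0I pr_set0 mul0r.
    rewrite !big_ord_recr/= setIUl mulrDl -iA//.
    have mI i : measurable (A i `&` A n) by exact: measurableI.
    apply: (le_trans (pr_setU_le (measurableI _ _ (mU m) (mA n)) (mI m))).
    by rewrite lerD2r IH// ltnW.
  exact.
elim: N => [|N IH]; first by rewrite !big_ord0 expr0n subr0 pr_set0.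
rewrite !big_ord_recr/= (pr_setU (mU N) (mA N)).
have := cross N; move: IH.
have : 0 <= \sum_(n < N) pr (A n) by apply: sumr_ge0 => i _; exact: pr_ge0.
have := pr_ge0 (A N).
set s := \sum_(n < N) _; set q := pr (A N); set u := pr _; set v := pr _.
nra.
Qed.

End real_probability.

(** * Independence of the past and the present *)

Section independence.
Context (d : measure_display) (T : measurableType d) (R : realType).
Variable P : probability T R.
Variable X : nat -> T -> R.
Hypothesis mX : forall i, measurable_fun setT (X i).

(** Generators of the sigma-algebra of the subfamily [X_i], [i] in [D];
    [D = setT] gives the whole sequence and [D = `I_n] its past before [n]. *)
Definition cylinders (D : set nat) : set (set T) :=
  [set A | exists (i : nat) (B : set R),
             [/\ D i, measurable B & A = X i @^-1` B]].

Lemma generated_salgebraE : generated_salgebra X = <<s cylinders setT >>.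
Proof.
rewrite /generated_salgebra /cylinders; congr (<<s _ >>).
apply/seteqP; split=> A [i [B]] => [[mB ->]|[_ mB ->]]; exists i, B; split => //.
Qed.

Lemma cylinders_measurable D A : <<s cylinders D >> A -> measurable A.
Proof.
apply: smallest_sub; first exact: sigma_algebra_measurable.
by move=> _ [i [B [_ mB ->]]]; rewrite -[_ @^-1` _]setTI; exact: mX.
Qed.

Lemma measurable_fun_cylinders D i : D i ->
  @measurable_fun _ _ (g_sigma_algebraType (cylinders D)) R setT (X i).
Proof.
move=> Di _ B mB; rewrite setTI; apply: sub_sigma_algebra.
by exists i, B.
Qed.

Lemma measurable_sum_cylinders D n (phi : nat -> R -> R) :
  (forall i, measurable_fun setT (phi i)) -> (forall i, (i < n)%N -> D i) ->
  @measurable_fun _ _ (g_sigma_algebraType (cylinders D)) R setT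
    (fun w => \sum_(i < n) phi i (X i w)).
Proof.
move=> mphi Dn.
apply: (@measurable_sum _ (g_sigma_algebraType (cylinders D))) => i.
apply: measurableT_comp; first exact: mphi.
by apply: measurable_fun_cylinders; exact: Dn.
Qed.

(** The cylinder events over the first [n] coordinates form a pi-system that
    generates the past; Dynkin's lemma then spreads the product rule. *)
Lemma indep_past : mutually_independent P X -> forall n A B,
  <<s cylinders `I_n >> A -> measurable B ->
  pr P (A `&` X n @^-1` B) = pr P A * pr P (X n @^-1` B).
Proof.
move=> iX n A B sA mB.
have mXB i C : measurable C -> measurable (X i @^-1` C).
  by move=> mC; rewrite -[_ @^-1` _]setTI; exact: mX.
pose G : set (set T) := [set A | exists C : nat -> set R,
  (forall i, measurable (C i)) /\
  A = \big[setI/setT]_(i <- iota 0 n) (X i @^-1` C i)].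
pose H : set (set T) := [set A | measurable A /\
  (P (A `&` X n @^-1` B) = P A * P (X n @^-1` B))%E].
have mG A' : G A' -> measurable A'.
  move=> [C [mC ->]]; elim/big_ind : _ => //; first exact: measurableI.
  by move=> i _; exact: mXB.
have GI : setI_closed G.
  move=> _ _ [C [mC ->]] [D [mD ->]]; exists (fun i => C i `&` D i).
  split; first by move=> i; exact: measurableI.
  by rewrite -big_split; apply: eq_bigr => i _; rewrite preimage_setI.
have GH : G `<=` H.
  move=> _ [C [mC ->]]; split; first by apply: mG; exists C.
  pose C' i := if (i < n)%N then C i else B.
  have mC' i : measurable (C' i) by rewrite /C'; case: ifP.
  have := iX (rcons (iota 0 n) n) C'.
  rewrite -cats1 cat_uniq iota_uniq/= mem_iota add0n ltnn andbF/= => /(_ isT mC').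
  rewrite !big_cat/= !big_seq1.
  rewrite (@eq_big_seq _ _ _ _ _ (fun i => X i @^-1` C' i) (fun i => X i @^-1` C i)).
    rewrite (@eq_big_seq _ _ _ _ _ (fun i => P (X i @^-1` C' i)) (fun i => P (X i @^-1` C i))).
      rewrite /C' ltnn => ->; congr (_ * _)%E.
      by rewrite iX// iota_uniq.
    by move=> i; rewrite mem_iota /C' /= => ->.
  by move=> i; rewrite mem_iota /C' /= => ->.
have HG : <<s G >> `<=` H.
  apply: (@lambda_system_subset _ _ GI setT) => //.
  split => //.
  - split; first exact: measurableT.
    by rewrite setTI probability_setT mul1e.
  - move=> A1 A2 A21 [m1 h1] [m2 h2]; split; first exact: measurableD.
    have -> : (A1 `\` A2) `&` X n @^-1` B =
              (A1 `&` X n @^-1` B) `\` (A2 `&` X n @^-1` B).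
      by apply/seteqP; split=> w /=; tauto.
    have mXn := mXB n _ mB.
    have mI C : measurable C -> measurable (C `&` X n @^-1` B).
      by move=> mC; exact: measurableI.
    have pM C : measurable C -> P (C `&` X n @^-1` B) = (P C * P (X n @^-1` B))%E ->
        pr P (C `&` X n @^-1` B) = pr P C * pr P (X n @^-1` B).
      move=> mC; rewrite (prE P mC) (prE P mXn) (prE P (mI _ mC)) -EFinM.
      exact: EFin_inj.
    rewrite (prE P (measurableD m1 m2)) (prE P mXn) -EFinM.
    rewrite (prE P (measurableD (mI _ m1) (mI _ m2))).
    rewrite (pr_setD P (mI _ m1) (mI _ m2)); last exact: setSI.
    by rewrite (pr_setD P m1 m2)// (pM _ m1 h1) (pM _ m2 h2) mulrBl.
  - move=> F ndF HF; have mF i : measurable (F i) by case: (HF i).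
    have mXn := mXB n _ mB.
    split; first exact: bigcupT_measurable.
    rewrite setI_bigcupl.
    have := @nondecreasing_cvg_mu _ _ _ P (fun i => F i `&` X n @^-1` B).
    move=> /(_ (fun i => measurableI _ _ (mF i) mXn)).
    move=> /(_ (bigcupT_measurable _ (fun i => measurableI _ _ (mF i) mXn))).
    have ndFX : nondecreasing_seq (fun i => F i `&` X n @^-1` B).
      by move=> p q pq; apply/subsetPset; apply: setSI; exact/subsetPset/ndF.
    move=> /(_ ndFX) cvgl.
    have cvgr := @nondecreasing_cvg_mu _ _ _ P F mF (bigcupT_measurable _ mF) ndF.
    have := @cvgeZr _ _ _ _ _ (P (X n @^-1` B)) (fin_num_measure _ _ mXn) cvgr.
    move=> {}cvgr; apply: (cvg_unique _ cvgl) => //.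
    apply: cvg_trans cvgr; apply: near_eq_cvg.
    by apply: nearW => i /=; case: (HF i) => _ ->.
have : H A.
  apply: HG; move: A sA; apply: smallest_sub; first exact: smallest_sigma_algebra.
  move=> _ [i [C [lin mC ->]]]; apply: sub_sigma_algebra.
  exists (fun j => if j == i then C else setT); split.
    by move=> j; case: ifP.
  rewrite (bigD1_seq i) ?iota_uniq ?mem_iota//= eqxx big1 ?setIT// => j /negbTE ->.
  by rewrite preimage_setT.
have mXn := mXB n _ mB.
move=> [mA]; rewrite (prE P mA) (prE P mXn) (prE P (measurableI _ _ mA mXn)).
by rewrite -EFinM; exact: EFin_inj.
Qed.
End independence.

(** * Expectation of a product of independent variables *)

Section product_expectation.
Context (d : measure_display) (T : measurableType d) (R : realType).
Variable P : probability T R.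

(** The joint law of independent variables is the product of the marginals, so
    the expectation of the product is a Fubini integral. *)
Lemma Rintegral_indepM (Y Z : {RV P >-> R}) :
  P.-integrable setT (EFin \o Y) -> P.-integrable setT (EFin \o Z) ->
  P.-integrable setT (EFin \o (Y \* Z)) ->
  (forall B C, measurable B -> measurable C ->
    pr P (Y @^-1` B `&` Z @^-1` C) = pr P (Y @^-1` B) * pr P (Z @^-1` C)) ->
  \int[P]_w (Y w * Z w) = (\int[P]_w Y w) * (\int[P]_w Z w).
Proof.
move=> iY iZ iYZ ind.
pose phi w := (Y w, Z w).
have mphi : measurable_fun setT phi by exact: measurable_fun_pair.
pose f := fun xy : R * R => (xy.1 * xy.2)%:E.
have mf : measurable_fun setT f.
  by apply/measurable_EFinP; apply: measurable_funM.
have lawE (A : set (R * R)) : measurable A ->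
    pushforward P phi A = (distribution P Y \x distribution P Z)%E A.
  move=> mA; apply/esym; apply: product_measure_unique => // B C mB mC.
  rewrite /pushforward/= /distribution/pushforward.
  have mYB : measurable (Y @^-1` B) by rewrite -[_ @^-1` _]setTI; exact: measurable_funP.
  have mZC : measurable (Z @^-1` C) by rewrite -[_ @^-1` _]setTI; exact: measurable_funP.
  have -> : phi @^-1` (B `*` C) = Y @^-1` B `&` Z @^-1` C by [].
  rewrite (prE P mYB) (prE P mZC) (prE P (measurableI _ _ mYB mZC)) ind//.
have joint : (\int[P]_w (f \o phi) w)%E =
    (\int[distribution P Y \x distribution P Z]_z f z)%E.
  rewrite -(@integral_pushforward _ _ _ _ _ _ mphi P setT)//.
  apply: eq_measure_integral => A mA _; exact: lawE.
have ifprod : (distribution P Y \x distribution P Z)%E.-integrable setT f.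
  apply/integrableP; split => //.
  have -> : (\int[distribution P Y \x distribution P Z]_z `|f z|)%E =
            (\int[pushforward P phi]_z `|f z|)%E.
    by apply: eq_measure_integral => A mA _; exact: (esym (lawE A mA)).
  have mfn : measurable_fun setT (fun z => `|f z|)%E by exact: measurableT_comp.
  rewrite (@ge0_integral_pushforward _ _ _ _ _ _ mphi P setT)//.
  by case/integrableP : iYZ.
rewrite /Rintegral.
have -> : (\int[P]_w (Y w * Z w)%:E)%E = (\int[P]_w (f \o phi) w)%E by [].
rewrite joint -integral12_prod_meas1// /fubini_F/=.
have fY := integrable_fin_num measurableT iY.
have fZ := integrable_fin_num measurableT iZ.
have lawZ (x : R) : (\int[distribution P Z]_y (x * y)%:E)%E = (x * \int[P]_w Z w)%:E.
  rewrite integral_distribution//=; last 2 first.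
  - by apply/measurable_EFinP; exact: measurable_funM.
  - apply: (eq_integrable _ (fun w => x%:E * (EFin \o Z) w)%E) => //.
    exact: integrableZl.
  under eq_integral do rewrite EFinM.
  by rewrite integralZl//= -[X in (_ * X)%E]fineK// -EFinM.
have -> : (\int[distribution P Y]_x \int[distribution P Z]_y (x * y)%:E)%E =
    (\int[distribution P Y]_x (x * \int[P]_w Z w)%:E)%E.
  by apply: eq_integral => x _; exact: lawZ.
rewrite integral_distribution//=; last 2 first.
- by apply/measurable_EFinP; exact: measurable_funM.
- apply: (eq_integrable _ (fun w => (EFin \o Y) w * (\int[P]_w Z w)%:E)%E) => //.
  exact: integrableZr.
under eq_integral do rewrite EFinM.
by rewrite integralZr//= fineM.
Qed.

Lemma Rintegral_indep_funM (Y Z : T -> R) :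
  measurable_fun setT Y -> measurable_fun setT Z ->
  P.-integrable setT (EFin \o Y) -> P.-integrable setT (EFin \o Z) ->
  P.-integrable setT (EFin \o (fun w => Y w * Z w)) ->
  (forall B C, measurable B -> measurable C ->
    pr P (Y @^-1` B `&` Z @^-1` C) = pr P (Y @^-1` B) * pr P (Z @^-1` C)) ->
  \int[P]_w (Y w * Z w) = (\int[P]_w Y w) * (\int[P]_w Z w).
Proof.
move=> mY mZ.
pose Y' : {RV P >-> R} := mfun_Sub (mem_set mY : Y \in mfun).
pose Z' : {RV P >-> R} := mfun_Sub (mem_set mZ : Z \in mfun).
exact: (@Rintegral_indepM Y' Z').
Qed.
End product_expectation.

(** * The Hajek-Renyi maximal inequality *)

Section real_expectation.
Context (d : measure_display) (T : measurableType d) (R : realType).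
Variable P : probability T R.

Local Notation itg f := (P.-integrable setT (EFin \o f)).

Lemma integrable_dom (f g : T -> R) : measurable_fun setT f ->
  (forall w, `|f w| <= g w) -> itg g -> itg f.
Proof.
move=> mf fg; apply: le_integrable => //; first exact/measurable_EFinP.
move=> w _ /=; rewrite lee_fin; apply: (le_trans (fg w)); exact: ler_norm.
Qed.

Lemma integrable_cstP (c : R) : itg (fun _ => c).
Proof. exact: finite_measure_integrable_cst. Qed.

Lemma Rintegral_cstP (c : R) : \int[P]_w c = c.
Proof.
rewrite Rintegral_cst//; have -> : fine (P setT) = 1 by rewrite probability_setT.
by rewrite mulr1.
Qed.

Lemma integrableDR (f g : T -> R) : itg f -> itg g -> itg (fun w => f w + g w).
Proof.
move=> fi gi; apply: (eq_integrable _ ((EFin \o f) \+ (EFin \o g))%E) => //.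
exact: integrableD.
Qed.

Lemma integrableZR (c : R) (f : T -> R) : itg f -> itg (fun w => c * f w).
Proof.
move=> fi; apply: (eq_integrable _ (fun w => c%:E * (EFin \o f) w)%E) => //.
exact: integrableZl.
Qed.

Lemma Rintegral_pr (A : set T) : measurable A -> \int[P]_w \1_A w = pr P A.
Proof. by move=> mA; rewrite /Rintegral integral_indic// setIT. Qed.


End real_expectation.

Section hajek_renyi.
Context (d : measure_display) (T : measurableType d) (R : realType).
Variable P : probability T R.
Local Notation itg f := (P.-integrable setT (EFin \o f)).
Variable X : nat -> T -> R.
Hypothesis mX : forall i, measurable_fun setT (X i).
Hypothesis iX : mutually_independent P X.
Variable phi : nat -> R -> R.
Hypothesis mphi : forall i, measurable_fun setT (phi i).
Let Z i w := phi i (X i w).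
Let S n w := \sum_(i < n) Z i w.
Variables v b : nat -> R.
Hypothesis Z2 : forall i, itg (fun w => phi i (X i w) ^+ 2).
Hypothesis Z0 : forall i, \int[P]_w phi i (X i w) = 0.
Hypothesis Zv : forall i, \int[P]_w (phi i (X i w) ^+ 2) <= v i.
Hypothesis b_gt0 : forall i, 0 < b i.
Hypothesis b_nd : forall i, b i <= b i.+1.

Let D n : set T := [set w | forall k, (k < n)%N -> `|S k.+1 w| <= b k].
Let G n := cylinders X `I_n.

Let iZ2 i : itg (fun w => Z i w ^+ 2).
Proof. exact: Z2. Qed.

Let Z_mean i : \int[P]_w Z i w = 0.
Proof. exact: Z0. Qed.

Let Z_var i : \int[P]_w (Z i w ^+ 2) <= v i.
Proof. exact: Zv. Qed.

Let mZ i : measurable_fun setT (Z i).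
Proof. exact: measurableT_comp. Qed.

Let mS n : measurable_fun setT (S n).
Proof. by apply: measurable_sum => i; exact: mZ. Qed.

Let S_past n m : (m <= n)%N -> @measurable_fun _ _ (g_sigma_algebraType (G n)) R setT (S m).
Proof.
by move=> mn; apply: measurable_sum_cylinders => // i im; exact: leq_trans mn.
Qed.

Let D_past n : <<s G n >> (D n).
Proof.
have -> : D n = \bigcap_k (if (k < n)%N then [set w | `|S k.+1 w| <= b k] else setT).
  apply/seteqP; split=> w.
    by move=> Dw k _; case: ifP => // kn; exact: Dw.
  by move=> Dw k kn; have := Dw k I; rewrite kn.
apply: (@bigcap_measurable _ (g_sigma_algebraType (G n))) => // k _.
case: ifP => kn; last exact: measurableT.
have -> : [set w | `|S k.+1 w| <= b k] = [set: g_sigma_algebraType (G n)] `&` S k.+1 @^-1` `[- b k, b k].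
  by rewrite setTI; apply/seteqP; split=> w /=; rewrite in_itv/= ler_norml.
exact: S_past.
Qed.

Let mD n : measurable (D n).
Proof. exact: (cylinders_measurable mX (@D_past n)). Qed.

Let iS2 n : itg (fun w => S n w ^+ 2).
Proof.
elim: n => [|n IH].
  apply: (eq_integrable _ (EFin \o (fun=> 0))) => //; last exact: integrable_cstP.
  by move=> w _; rewrite /= /S big_ord0 expr0n.
apply: (@integrable_dom _ _ _ _ _ (fun w => 2 * S n w ^+ 2 + 2 * Z n w ^+ 2)).
- exact: measurable_funX.
- move=> w; rewrite ger0_norm ?sqr_ge0// /S big_ord_recr/= -/(S n w).
  by have := sqr_ge0 (S n w - Z n w); nra.
- by apply: integrableDR; apply: integrableZR.
Qed.

Let Y n w := S n w * \1_(D n) w.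

Let mY n : measurable_fun setT (Y n).
Proof. by apply: measurable_funM => //; exact: measurable_indic. Qed.

Let Y_le n w : `|Y n w| <= 1 + S n w ^+ 2.
Proof.
rewrite /Y normrM indicE -(real_normK (num_real (S n w))).
have := sqr_ge0 (`|S n w| - 1); have := normr_ge0 (S n w).
by case: (w \in D n); rewrite /= ?normr1 ?normr0; nra.
Qed.

Let cross n : itg (fun w => Y n w * Z n w) /\ \int[P]_w (Y n w * Z n w) = 0.
Proof.
have iZ : itg (Z n).
  apply: (@integrable_dom _ _ _ _ _ (fun w => 1 + Z n w ^+ 2)) => //.
    move=> w; rewrite -(real_normK (num_real (Z n w))).
    by have := sqr_ge0 (`|Z n w| - 1); have := normr_ge0 (Z n w); nra.
  by apply: integrableDR => //; exact: integrable_cstP.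
have iY : itg (Y n).
  apply: (@integrable_dom _ _ _ _ _ (fun w => 1 + S n w ^+ 2)) => //.
  by apply: integrableDR => //; exact: integrable_cstP.
have iYZ : itg (fun w => Y n w * Z n w).
  apply: (@integrable_dom _ _ _ _ _ (fun w => S n w ^+ 2 + Z n w ^+ 2)) => //.
  - exact: measurable_funM.
  - move=> w; rewrite normrM /Y normrM indicE.
    rewrite -(real_normK (num_real (Z n w))) -(real_normK (num_real (S n w))).
    have := sqr_ge0 (`|S n w| - `|Z n w|).
    have := normr_ge0 (Z n w); have := normr_ge0 (S n w).
    by case: (w \in D n); rewrite /= ?normr1 ?normr0; nra.
  - exact: integrableDR.
split => //; rewrite (Rintegral_indep_funM (mY n) (mZ n))// ?Z_mean ?mulr0// => B C mB mC.
have -> : Z n @^-1` C = X n @^-1` (phi n @^-1` C) by [].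
apply: (indep_past mX iX).
  have : @measurable_fun _ _ (g_sigma_algebraType (G n)) R setT (Y n).
    apply: measurable_funM; first exact: S_past.
    by apply: measurable_indic; exact: D_past.
  by move=> /(_ measurableT B mB); rewrite setTI.
by rewrite -[_ @^-1` _]setTI; exact: mphi.
Qed.

Let W n w := \1_(~` D n) w + (b n) ^- 2 * (S n w ^+ 2 * \1_(D n) w).

Let W_step n w : W n.+1 w <=
  W n w + ((b n) ^- 2 * 2 * (Y n w * Z n w) + (b n) ^- 2 * Z n w ^+ 2).
Proof.
have b2 : 0 <= (b n) ^- 2 by rewrite invr_ge0 sqr_ge0.
rewrite /W /Y !indicE !in_setC.
have SE : S n.+1 w = S n w + Z n w by rewrite /S big_ord_recr.
have [wD|wD] := boolP (w \in D n); last first.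
  have -> : (w \in D n.+1) = false.
    apply/negbTE; apply: contra wD; rewrite !inE => wD k kn; apply: wD.
    exact: ltnW.
  by have := mulr_ge0 b2 (sqr_ge0 (Z n w)); rewrite /=; lra.
have [wD1|wD1] := boolP (w \in D n.+1) => /=.
  rewrite !mulr1 !add0r SE.
  have : (b n.+1) ^- 2 * (S n w + Z n w) ^+ 2 <= (b n) ^- 2 * (S n w + Z n w) ^+ 2.
    apply: ler_wpM2r; first exact: sqr_ge0.
    rewrite lef_pV2 ?posrE ?exprn_gt0//.
    by apply: lerXn2r => //; rewrite nnegrE ltW.
  by move/le_trans; apply; rewrite le_eqVlt; apply/orP; left; apply/eqP; ring.
have : b n < `|S n.+1 w|.
  rewrite ltNge; apply: contra wD1 => Sb; rewrite inE => k.
  rewrite ltnS leq_eqVlt => /predU1P[->//|kn].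
  by move: wD; rewrite inE; exact.
move=> bS; rewrite !mulr0 !mulr1 add0r addr0.
have : 1 <= (b n) ^- 2 * S n.+1 w ^+ 2.
  rewrite mulrC ler_pdivlMr ?exprn_gt0// mul1r -(real_normK (num_real (S _ _))).
  by apply: lerXn2r; rewrite ?nnegrE// ltW.
by move/le_trans; apply; rewrite SE le_eqVlt; apply/orP; left; apply/eqP; ring.
Qed.

Let iSD n : itg (fun w => S n w ^+ 2 * \1_(D n) w).
Proof.
apply: (@integrable_dom _ _ _ _ _ (fun w => S n w ^+ 2)) => //.
- apply: measurable_funM; first exact: measurable_funX.
  exact: measurable_indic.
- move=> w; rewrite indicE normrM ger0_norm ?sqr_ge0//.
  have := sqr_ge0 (S n w).
  by case: (w \in D n); rewrite /= ?normr1 ?normr0; lra.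
Qed.

Let iI (A : set T) : measurable A -> itg (\1_A : T -> R).
Proof.
move=> mA; apply: (@integrable_dom _ _ _ _ _ (fun=> 1)) => //.
- move=> w; rewrite indicE.
  by case: (w \in A); rewrite /= ?normr1 ?normr0.
- exact: integrable_cstP.
Qed.

Let iW n : itg (W n).
Proof.
apply: integrableDR; first by apply: iI; exact: measurableC.
exact: integrableZR.
Qed.

Let W_bound n : \int[P]_w W n w <= \sum_(k < n) v k / b k ^+ 2.
Proof.
elim: n => [|n IH].
  rewrite big_ord0; have -> : \int[P]_w W 0%N w = \int[P]_w (fun=> 0) w.
    apply: eq_Rintegral => w _; rewrite /W !indicE in_setC.
    have -> : w \in D 0%N by rewrite inE.
    by rewrite /S big_ord0 expr0n/= mul0r mulr0 addr0.
  by rewrite Rintegral_cstP.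
have [iYZ YZ0] := cross n.
rewrite big_ord_recr/=; apply: (@le_trans _ _ (\int[P]_w (W n w +
    ((b n) ^- 2 * 2 * (Y n w * Z n w) + (b n) ^- 2 * Z n w ^+ 2)))).
  apply: le_Rintegral => //.
  by apply: integrableDR => //; apply: integrableDR; exact: integrableZR.
rewrite RintegralD//; last by apply: integrableDR; exact: integrableZR.
rewrite lerD// RintegralD//; try exact: integrableZR.
rewrite !RintegralZl// YZ0 mulr0 add0r mulrC ler_wpM2r// invr_ge0.
exact: sqr_ge0.
Qed.

(** The potential [W n] is the indicator of a crossing before [n] plus, on the
    complement, the square of the walk divided by [b n ^+ 2]. It starts at 0 and
    dominates the indicator. Its mean grows by at most [v n / b n ^+ 2] per step:
    the boundary increases, and the cross term [Y n * Z n] has mean 0 because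
    [Y n] depends on the past of [n] only. *)
Theorem hajek_renyi (c : R) : (forall N, \sum_(k < N) v k / b k ^+ 2 <= c) ->
  pr P [set w | exists n, b n < `|\sum_(i < n.+1) phi i (X i w)|] <= c.
Proof.
move=> bc.
have -> : [set w | exists n, b n < `|\sum_(i < n.+1) phi i (X i w)|] =
    \bigcup_n (~` D n).
  apply/seteqP; split=> w.
    move=> [n Sn]; exists n.+1 => //= /(_ n (ltnSn n)); rewrite leNgt.
    by move=> /negP; apply.
  move=> [n _ /=]; apply: contra_notP => /forallNP H k kn; rewrite leNgt.
  by apply/negP; exact: H.
apply: pr_bigcup_nd.
- by move=> n; exact: measurableC.
- move=> m n mn; apply: subsetC => w Dw k km; apply: Dw; exact: leq_trans mn.
- move=> n; apply: le_trans (bc n); apply: le_trans (W_bound n).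
  have mDC : measurable (~` D n) by exact: measurableC.
  rewrite -(Rintegral_pr P mDC); apply: le_Rintegral => //; first exact: iI.
  move=> w _; rewrite lerDl mulr_ge0// ?invr_ge0 ?sqr_ge0// mulr_ge0 ?sqr_ge0//.

Qed.

End hajek_renyi.

(** * Ruin events at arrival epochs *)

Section crossing.
Context (T : Type) (R : realType).
Variables zeta sigma : nat -> T -> R.
Hypothesis zeta_ge0 : forall i w, 0 <= zeta i w.
Hypothesis sigma_ge0 : forall i w, 0 <= sigma i w.

Definition claim_sum (n : nat) (w : T) : R := \sum_(i < n) sigma i w.

Lemma claim_sum_nd w : {homo claim_sum^~ w : m n / (m <= n)%N >-> m <= n}.
Proof.
apply: homo_leq => // [y x z|n]; first exact: le_trans.
by rewrite /claim_sum big_ord_recr/= lerDl.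
Qed.

Lemma arrival_time_nd w : {homo (arrival_time zeta)^~ w : m n / (m <= n)%N >-> m <= n}.
Proof.
apply: homo_leq => // [y x z|n]; first exact: le_trans.
by rewrite /arrival_time big_ord_recr/= lerDl.
Qed.

Lemma arrival_time_ge0 n w : 0 <= arrival_time zeta n w.
Proof. by apply: sumr_ge0. Qed.

Lemma total_claimsE n t w :
  arrival_time zeta n w <= t < arrival_time zeta n.+1 w ->
  total_claims zeta sigma t w = claim_sum n w.
Proof.
move=> /andP[nt tn]; rewrite /total_claims/renewal_count (@xget_unique _ _ _ n)//.
  split => // k kt; rewrite leqNgt; apply/negP => nk.
  by have := lt_le_trans tn (le_trans (arrival_time_nd w nk) kt); rewrite ltxx.
move=> m [mt mmax]; apply/eqP; rewrite eqn_leq mmax// andbT.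
rewrite leqNgt; apply/negP => nm.
by have := lt_le_trans tn (le_trans (arrival_time_nd w nm) mt); rewrite ltxx.
Qed.

Lemma total_claims_gt0 t w : 0 < total_claims zeta sigma t w ->
  exists n, arrival_time zeta n w <= t < arrival_time zeta n.+1 w.
Proof.
rewrite /total_claims/renewal_count; case: xgetP => [n _ [nt nmax] _|].
  exists n; rewrite nt/= ltNge; apply/negP => /nmax.
  by rewrite ltnn.
by move=> _; rewrite big_ord0 ltxx.
Qed.

(** A barrier [g] that increases can only be overtaken at a claim, so that ruin
    can be read at the arrival epochs. The strict inequality between arrival
    times selects the last of several simultaneous arrivals; it also fits the
    paths with bounded arrival times, on which [renewal_count] is 0 beyond the
    limit. *)
Definition crossing (g : R -> R) : set T :=
  [set w | exists n, arrival_time zeta n w < arrival_time zeta n.+1 w /\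
                     g (arrival_time zeta n w) < claim_sum n w].

Lemma crossingP (g : R -> R) w : 0 <= g 0 -> {homo g : x y / x <= y} ->
  (exists2 t, 0 <= t & g t < total_claims zeta sigma t w) <-> crossing g w.
Proof.
move=> g0 g_nd; split=> [[t t0 gt]|[n [nn gn]]].
  have S0 : 0 < total_claims zeta sigma t w.
    by apply: le_lt_trans gt; apply: le_trans g0 (g_nd _ _ t0).
  have [n /[dup] /andP[nt tn] ntn] := total_claims_gt0 S0; exists n; split.
    exact: le_lt_trans nt tn.
  by rewrite -(total_claimsE ntn); apply: le_lt_trans gt; exact: g_nd.
exists (arrival_time zeta n w); first exact: arrival_time_ge0.
by rewrite (@total_claimsE n)// lexx.
Qed.

(** When the arrival times are unbounded, every index precedes a last index with
    the same arrival time, and the claims only increase in between. *)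
Lemma crossing_of_lt (g : R -> R) n w :
  (forall x, exists m, x < arrival_time zeta m w) ->
  g (arrival_time zeta n w) < claim_sum n w -> crossing g w.
Proof.
move=> /(_ (arrival_time zeta n w)) ex gn.
case: (ex_minnP ex) => -[|m]; first by rewrite ltNge (arrival_time_nd w (leq0n n)).
move=> nm mmin; have mn : arrival_time zeta m w <= arrival_time zeta n w.
  by rewrite leNgt; apply/negP => /mmin; rewrite ltnn.
have nm' : (n <= m)%N.
  rewrite leqNgt; apply/negP => mn'.
  by have := lt_le_trans nm (arrival_time_nd w mn'); rewrite ltxx.
exists m; split; first exact: le_lt_trans nm.
have -> : arrival_time zeta m w = arrival_time zeta n w.
  by apply/eqP; rewrite eq_le mn (arrival_time_nd w nm').
exact: lt_le_trans gn (claim_sum_nd w nm').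
Qed.

End crossing.

Section crossing_probability.
Context (d : measure_display) (T : measurableType d) (R : realType).
Variable P : probability T R.
Variables zeta sigma : nat -> T -> R.
Hypothesis mzeta : forall i, measurable_fun setT (zeta i).
Hypothesis msigma : forall i, measurable_fun setT (sigma i).
Hypothesis zeta_ge0 : forall i w, 0 <= zeta i w.
Variables p1 p2 x1 x2 : R.
Hypothesis p1_gt0 : 0 < p1.
Hypothesis p2_gt0 : 0 < p2.
Hypothesis x1_gt0 : 0 < x1.
Hypothesis x2_gt0 : 0 < x2.
Let b1 t := x1 + p1 * t.
Let b2 t := x2 + p2 * t.

Lemma measurable_claim_sum n : measurable_fun setT (claim_sum sigma n).
Proof. exact: measurable_sum. Qed.

Lemma measurable_arrival_time n : measurable_fun setT (arrival_time zeta n).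
Proof. exact: measurable_sum. Qed.

Lemma measurable_ltr_set (f g : T -> R) : measurable_fun setT f ->
  measurable_fun setT g -> measurable [set w | f w < g w].
Proof.
move=> mf mg; have := measurable_fun_ltr mf mg.
by move=> /(_ measurableT [set true] I); rewrite setTI.
Qed.

Lemma measurable_crossing g : measurable_fun setT g ->
  measurable (crossing zeta sigma g).
Proof.
move=> mg; have -> : crossing zeta sigma g =
  \bigcup_n ([set w | arrival_time zeta n w < arrival_time zeta n.+1 w] `&`
             [set w | g (arrival_time zeta n w) < claim_sum sigma n w]).
  by apply/seteqP; split=> w [n]; [exists n|move=> _; exists n].
apply: bigcupT_measurable => n; apply: measurableI.
  by apply: measurable_ltr_set; exact: measurable_arrival_time.
apply: measurable_ltr_set; last exact: measurable_claim_sum.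
by apply: measurableT_comp => //; exact: measurable_arrival_time.
Qed.

Let b1_ge0 : 0 <= b1 0. Proof. by rewrite /b1 mulr0 addr0 ltW. Qed.
Let b2_ge0 : 0 <= b2 0. Proof. by rewrite /b2 mulr0 addr0 ltW. Qed.
Let b1_nd : {homo b1 : x y / x <= y}.
Proof. by move=> x y xy; rewrite lerD2l ler_pM2l. Qed.
Let b2_nd : {homo b2 : x y / x <= y}.
Proof. by move=> x y xy; rewrite lerD2l ler_pM2l. Qed.

Lemma psi_andE : psi_and P zeta sigma p1 p2 x1 x2 =
  pr P (crossing zeta sigma (fun t => Num.min (b1 t) (b2 t))).
Proof.
congr (fine (P _)); apply/seteqP; split=> w /(crossingP _ zeta_ge0); apply.
- by rewrite le_min b1_ge0.
- by move=> x y xy; rewrite le_min !ge_min b1_nd// b2_nd// orbT.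
- by rewrite le_min b1_ge0.
- by move=> x y xy; rewrite le_min !ge_min b1_nd// b2_nd// orbT.
Qed.

Lemma psi_orE : psi_or P zeta sigma p1 p2 x1 x2 =
  pr P (crossing zeta sigma (fun t => Num.max (b1 t) (b2 t))).
Proof.
congr (fine (P _)); apply/seteqP; split=> w /(crossingP _ zeta_ge0); apply.
- by rewrite le_max b1_ge0.
- by move=> x y xy; rewrite ge_max !le_max b1_nd// b2_nd// orbT.
- by rewrite le_max b1_ge0.
- by move=> x y xy; rewrite ge_max !le_max b1_nd// b2_nd// orbT.
Qed.

Lemma psi_timesE : psi_times P zeta sigma p1 p2 x1 x2 =
  pr P (crossing zeta sigma b1 `&` crossing zeta sigma b2).
Proof.
congr (fine (P _)); apply/seteqP; split=> w.
  move=> [t [u [t0 u0 tb ub]]]; split; apply/crossingP => //.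
    by exists t.
  by exists u.
move=> [/(crossingP _ zeta_ge0)[]// t t0 tb /(crossingP _ zeta_ge0)[]// u u0 ub].
by exists t, u.
Qed.

End crossing_probability.

(** * Power functions and regularly varying tails *)

Section power_tails.
Context (R : realType).
Implicit Types x y s r : R.

Lemma powRN_le s x y : 0 <= s -> 0 < x -> x <= y -> y `^ (- s) <= x `^ (- s).
Proof.
move=> s0 x0 xy; have y0 := lt_le_trans x0 xy.
rewrite !powRN lef_pV2 ?posrE ?powR_gt0// ge0_ler_powR// ?nnegrE ltW//.
Qed.

Lemma powR_inv_root s r : s != 0 -> 0 < r ->
  exists2 t : R, 0 < t & forall x : R, 0 <= x -> (t * x) `^ s = r * x `^ s.
Proof.
move=> s0 r0; exists (r `^ s^-1); first exact: powR_gt0.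
by move=> x x0; rewrite powRM ?powR_ge0// -powRrM mulVf// powRr1// ltW.
Qed.

(** Bernoulli's inequality [(1 - 1 / x) `^ (1 - s) >= 1 + (s - 1) / x], multiplied
    by [x `^ (1 - s)]. *)
Lemma powR_telescope s x : 1 < s -> 1 < x ->
  (s - 1) * x `^ (- s) <= (x - 1) `^ (1 - s) - x `^ (1 - s).
Proof.
move=> s1 x1; have x0 : 0 < x by lra.
have u0 : 0 < 1 - x^-1 by rewrite subr_gt0 invf_lt1.
have -> : x - 1 = x * (1 - x^-1) by rewrite mulrBr mulr1 mulfV ?gt_eqF.
have -> : x `^ (- s) = x `^ (1 - s) * x^-1.
  have E : 1 - s + -1 = - s :> R by ring.
  by rewrite -[x^-1]powR_inv1 ?ltW// -powRD ?E// (gt_eqF x0) implybT.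
rewrite (powRM _ (ltW x0) (ltW u0)).
have lnu : ln (1 - x^-1) <= - x^-1.
  by apply: le_ln1Dx; rewrite ltrN2 invf_lt1.
have : 1 + (s - 1) * x^-1 <= (1 - x^-1) `^ (1 - s).
  rewrite /powR gt_eqF//; apply: le_trans (expR_ge1Dx _).
  rewrite lerD2l; have := @mulr_ge0 _ (s - 1) (- x^-1 - ln (1 - x^-1)) ltac:(lra) ltac:(lra).
  by lra.
by move=> /(ler_wpM2l (powR_ge0 x (1 - s))); lra.
Qed.

(** [powR_telescope] plays the role of the integral of [x `^ (- s)]. *)
Lemma powR_sum_le s K N : 1 < s -> 2 <= K ->
  \sum_(i < N) (i%:R + K) `^ (- s) <= (s - 1)^-1 * 2 `^ (s - 1) * K `^ (1 - s).
Proof.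
move=> s1 K2; have s10 : 0 < s - 1 by lra.
rewrite -mulrA ler_pdivlMl//.
have tel : (s - 1) * (\sum_(i < N) (i%:R + K) `^ (- s)) <=
    (K - 1) `^ (1 - s) - (N%:R + K - 1) `^ (1 - s).
  elim: N => [|N IH]; first by rewrite big_ord0 mulr0 add0r subrr.
  rewrite big_ord_recr/= mulrDr.
  have N0 : 0 <= N%:R :> R by [].
  have := @powR_telescope s (N%:R + K) s1; rewrite -natr1.
  have -> : N%:R + 1 + K - 1 = N%:R + K :> R by ring.
  by move=> /(_ ltac:(lra)); lra.
apply: (le_trans tel); apply: (@le_trans _ _ ((K - 1) `^ (1 - s))).
  by rewrite gerBl powR_ge0.
have -> : 2 `^ (s - 1) * K `^ (1 - s) = (2^-1 * K) `^ (1 - s).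
  rewrite powRM//; last by lra.
  congr (_ * _); rewrite -powR_inv1// -powRrM; congr (powR _ _); ring.
have -> : 1 - s = - (s - 1) by ring.
by apply: powRN_le; lra.
Qed.

End power_tails.

Section regular_variation.
Context (R : realType).
Variables (F : R -> R) (A alpha : R).
Hypothesis A_gt0 : 0 < A.
Hypothesis alpha_gt1 : 1 < alpha.
Hypothesis F_asymp : asymp_equiv F (fun x => A * x `^ (- alpha)).

Lemma tail_sandwich (tau : R) : 0 < tau -> exists2 x0 : R, 0 < x0 & forall x : R, x0 <= x ->
  (1 - tau) * (A * x `^ (- alpha)) <= F x <= (1 + tau) * (A * x `^ (- alpha)).
Proof.
move=> tau0; move/cvgrPdist_le : F_asymp => /(_ _ tau0)[M [_ HM]].
exists (Num.max 1 (M + 1)); first by rewrite lt_max ltr01.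
move=> x; rewrite ge_max => /andP[x1 Mx].
have x0 : 0 < x by lra.
have D0 : 0 < A * x `^ (- alpha) by rewrite mulr_gt0// powR_gt0.
have /= := HM x ltac:(lra); rewrite ler_distlC.
by rewrite ler_pdivrMr// ler_pdivlMr.
Qed.

(** [F (th * x) / F x] tends to [th `^ (- alpha)], which the choice of [th] makes
    equal to [1 + eps / 4]; the sandwich with relative error [eps / 8] absorbs the
    rest. *)
Lemma tail_scale_up (eps : R) : 0 < eps -> eps <= 1 ->
  exists th x0 : R, [/\ 0 < th, th < 1, 0 < x0 &
    forall x : R, x0 <= x -> F (th * x) <= (1 + eps) * F x].
Proof.
move=> e0 e1; have e2 : eps * eps <= eps by rewrite ger_pMl.
have al0 : - alpha != 0.
  by rewrite oppr_eq0 (gt_eqF (lt_trans ltr01 alpha_gt1)).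
have [th th0 thE] := @powR_inv_root _ (- alpha) (1 + eps / 4) al0 ltac:(lra).
have [x0 x00 Hx] := @tail_sandwich (eps / 8) ltac:(lra).
have th1 : th < 1.
  rewrite ltNge; apply/negP => th1; have := thE 1 ltac:(lra).
  rewrite mulr1 powR1 mulr1 => thE1.
  have al : 0 <= alpha by have := alpha_gt1; lra.
  have := @powRN_le _ alpha 1 th al ltr01 th1.
  by rewrite powR1 thE1; lra.
exists th, (x0 / th); split => //; first exact: divr_gt0.
move=> x; rewrite ler_pdivrMr// => xx.
have xp : 0 < x by nra.
have /andP[_ up] := Hx (th * x) ltac:(lra).
have /andP[lo _] := Hx x ltac:(nra).
apply: (le_trans up); rewrite (thE _ (ltW xp)).
have D0 : 0 < A * x `^ (- alpha) by rewrite mulr_gt0// powR_gt0.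
move: lo D0; set D := A * _ => lo D0.
have -> : A * ((1 + eps / 4) * x `^ (- alpha)) = (1 + eps / 4) * D by rewrite /D; ring.
apply: (@le_trans _ _ ((1 + eps) * ((1 - eps / 8) * D))); last by rewrite ler_pM2l//; lra.
by rewrite [leLHS]mulrA [leRHS]mulrA ler_pM2r//; lra.
Qed.

Lemma tail_scale_down (eps : R) : 0 < eps -> eps <= 1 ->
  exists th x0 : R, [/\ 1 < th, 0 < x0 &
    forall x : R, x0 <= x -> (1 - eps) * F x <= F (th * x)].
Proof.
move=> e0 e1; have e2 : eps * eps <= eps by rewrite ger_pMl.
have al0 : - alpha != 0.
  by rewrite oppr_eq0 (gt_eqF (lt_trans ltr01 alpha_gt1)).
have [th th0 thE] := @powR_inv_root _ (- alpha) (1 - eps / 4) al0 ltac:(lra).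
have [x0 x00 Hx] := @tail_sandwich (eps / 8) ltac:(lra).
have th1 : 1 < th.
  rewrite ltNge; apply/negP => th1; have := thE 1 ltac:(lra).
  rewrite mulr1 powR1 mulr1 => thE1.
  have al : 0 <= alpha by have := alpha_gt1; lra.
  have := @powRN_le _ alpha th 1 al th0 th1.
  by rewrite powR1 thE1; lra.
exists th, x0; split => //.
move=> x xx; have xp : 0 < x by lra.
have /andP[lo _] := Hx (th * x) ltac:(nra).
have /andP[_ up] := Hx x xx.
apply: le_trans lo; rewrite (thE _ (ltW xp)).
have D0 : 0 < A * x `^ (- alpha) by rewrite mulr_gt0// powR_gt0.
move: up D0; set D := A * _ => up D0.
have -> : A * ((1 - eps / 4) * x `^ (- alpha)) = (1 - eps / 4) * D by rewrite /D; ring.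
have [->|e1'] := eqVneq eps 1; first by rewrite subrr mul0r; nra.
have e11 : 0 < 1 - eps by rewrite subr_gt0 lt_neqAle e1' e1.
apply: (@le_trans _ _ ((1 - eps) * ((1 + eps / 8) * D))); first by rewrite ler_pM2l//; lra.
by rewrite [leLHS]mulrA [leRHS]mulrA ler_pM2r//; nra.
Qed.

Lemma tail_upper : (forall x, F x <= 1) ->
  exists2 C : R, 0 < C & forall x : R, 0 < x -> F x <= C * x `^ (- alpha).
Proof.
move=> F1; have [x0 x00 Hx] := @tail_sandwich 1 ltac:(lra).
exists (2 * A + x0 `^ alpha); first by rewrite addr_gt0 ?mulr_gt0 ?powR_gt0.
move=> x xp; have Dp : 0 < x `^ (- alpha) by rewrite powR_gt0.
have [xx|xx] := leP x0 x.
  have /andP[_ up] := Hx x xx; apply: (le_trans up).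
  by have := mulr_gt0 (powR_gt0 alpha x00) Dp; lra.
apply: (le_trans (F1 x)).
have : 1 <= x0 `^ alpha * x `^ (- alpha).
  rewrite powRN ler_pdivlMr ?powR_gt0// mul1r ge0_ler_powR// ?nnegrE ltW//.
  by have := alpha_gt1; lra.
by have := mulr_gt0 A_gt0 Dp; lra.
Qed.

Lemma tail_lower :
  exists2 c : R, 0 < c & exists2 x0 : R, 0 < x0 & forall x : R, x0 <= x -> c * x `^ (- alpha) <= F x.
Proof.
have [x0 x00 Hx] := @tail_sandwich (1 / 2) ltac:(lra).
exists (A / 2); first by rewrite divr_gt0.
exists x0 => // x xx; have /andP[lo _] := Hx x xx.
by apply: le_trans lo; rewrite le_eqVlt; apply/orP; left; apply/eqP; field.
Qed.

End regular_variation.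

(** * Sums and integrals of monotone functions *)

Section sum_integral.
Context (R : realType).
Variable h : R -> R.
Hypothesis h_ge0 : forall x, 0 <= h x.
Hypothesis mh : measurable_fun setT h.
Hypothesis h_ni : forall x y, 0 <= x -> x <= y -> h y <= h x.

Local Notation leb := (@lebesgue_measure R).
Let U (n : nat) : set R := `[n%:R, n.+1%:R[%classic.

Let itv0yE : `[0, +oo[%classic = \bigcup_n U n :> set R.
Proof.
apply/seteqP; split=> x /=.
  rewrite in_itv/= andbT => x0; exists (Num.truncn x) => //.
  by rewrite /U/= in_itv/=; exact: truncn_itv.
move=> [n _]; rewrite /U/= !in_itv/= andbT => /andP[nx _].
exact: le_trans nx.
Qed.

Let U_triv : trivIset setT U.
Proof.
apply/trivIsetP => i j _ _ ij; apply/seteqP; split=> // x [].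
rewrite /U/= !in_itv/= => /truncn_def xi /truncn_def xj.
by move/eqP: ij; rewrite -xi -xj.
Qed.

Let leU n : leb (U n) = 1%E.
Proof.
by rewrite /U lebesgue_measure_itv/= lte_fin ltr_nat ltnSn -EFinB -natr1 addrAC subrr add0r.
Qed.

Let mU n : measurable_fun (U n) (EFin \o h).
Proof. by apply/measurable_EFinP; exact: measurable_funTS. Qed.

Let integralE : (\int[leb]_(x in `[0%R, +oo[) (h x)%:E =
  \sum_(0 <= n <oo) \int[leb]_(x in U n) (h x)%:E)%E.
Proof.
rewrite itv0yE ge0_integral_bigcup//.
- by move=> n; exact: measurable_itv.
- by apply/measurable_EFinP; exact: measurable_funTS.
- by move=> x _; rewrite lee_fin.
Qed.

Let U_le n : (\int[leb]_(x in U n) (h x)%:E <= (h n%:R)%:E)%E.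
Proof.
apply: (@le_trans _ _ (\int[leb]_(x in U n) (h n%:R)%:E)%E).
  apply: ge0_le_integral => //.
  - exact: measurable_itv.
  - by move=> x _; rewrite lee_fin.
  - exact: mU.
  - by move=> x; rewrite /U/= in_itv/= => /andP[nx _]; rewrite lee_fin h_ni.
rewrite integral_cst; last exact: measurable_itv.
  by rewrite [X in (_ * X)%E]leU mule1.
Qed.

Let U_ge n : ((h n.+1%:R)%:E <= \int[leb]_(x in U n) (h x)%:E)%E.
Proof.
apply: (@le_trans _ _ (\int[leb]_(x in U n) (h n.+1%:R)%:E)%E).
  rewrite integral_cst; last exact: measurable_itv.
  by rewrite [X in (_ * X)%E]leU mule1.
apply: ge0_le_integral => //.
- exact: measurable_itv.
- by move=> x _; rewrite lee_fin.
- exact: mU.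
- move=> x; rewrite /U/= in_itv/= => /andP[nx xn]; rewrite lee_fin; apply: h_ni; last exact: ltW.
  exact: le_trans nx.
Qed.

Lemma integrable_of_sum C : (forall N, \sum_(i < N) h i%:R <= C) ->
  leb.-integrable `[0, +oo[ (EFin \o h) /\ \int[leb]_(x in `[0, +oo[) h x <= C.
Proof.
move=> hC.
have le : (\int[leb]_(x in `[0%R, +oo[) (h x)%:E <= C%:E)%E.
  rewrite integralE; apply: lime_le.
    by apply: is_cvg_nneseries => n _ _; apply: integral_ge0 => x _; rewrite lee_fin.
  apply: nearW => N; apply: (@le_trans _ _ (\sum_(0 <= i < N) (h i%:R)%:E)%E).
    by apply: lee_sum => i _; exact: U_le.
  by rewrite big_mkord sumEFin lee_fin.
have i : leb.-integrable `[0, +oo[ (EFin \o h).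
  apply/integrableP; split; first by apply/measurable_EFinP; exact: measurable_funTS.
  under eq_integral do rewrite /= ger0_norm//.
  exact: le_lt_trans le (ltry _).
split => //; rewrite /Rintegral -lee_fin fineK//.
exact: integrable_fin_num.
Qed.

Lemma sum_le_integral N : leb.-integrable `[0, +oo[ (EFin \o h) ->
  \sum_(i < N) h i.+1%:R <= \int[leb]_(x in `[0, +oo[) h x.
Proof.
move=> ih; rewrite /Rintegral -lee_fin fineK; last exact: integrable_fin_num.
rewrite integralE; apply: (@le_trans _ _ (\sum_(0 <= i < N) \int[leb]_(x in U i) (h x)%:E)%E).
  by rewrite big_mkord -sumEFin; apply: lee_sum => i _; exact: U_ge.
by apply: nneseries_lim_ge => n _ _; apply: integral_ge0 => x _; rewrite lee_fin.
Qed.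

End sum_integral.

(** * Tails, truncations and their integrals *)

Section identically_distributed.
Context (d : measure_display) (T : measurableType d) (R : realType).
Variable P : probability T R.
Variable X : nat -> {RV P >-> R}.
Hypothesis idX : identically_distributed P X.

Lemma ge0_integral_ident (g : R -> R) i j : measurable_fun setT g ->
  (forall x, 0 <= g x) ->
  (\int[P]_w (g (X i w))%:E = \int[P]_w (g (X j w))%:E)%E.
Proof.
move=> mg g0.
have E k : (\int[P]_w (g (X k w))%:E = \int[distribution P (X k)]_x (g x)%:E)%E.
  rewrite ge0_integral_distribution//; first exact/measurable_EFinP.
by rewrite !E; apply: eq_measure_integral => A mA _; exact: idX.
Qed.

Lemma integrable_ident (g : R -> R) i j : measurable_fun setT g ->
  (forall x, 0 <= g x) -> P.-integrable setT (fun w => (g (X i w))%:E) ->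
  P.-integrable setT (fun w => (g (X j w))%:E).
Proof.
move=> mg g0 /integrableP[_ fi]; apply/integrableP; split.
  by apply/measurable_EFinP; exact: measurableT_comp.
rewrite (_ : (\int[P]_w `|(g (X j w))%:E|)%E = (\int[P]_w `|(g (X i w))%:E|)%E)//.
under eq_integral do rewrite abse_EFin ger0_norm//.
under [in RHS]eq_integral do rewrite abse_EFin ger0_norm//.
exact: ge0_integral_ident.
Qed.

Lemma Rintegral_ident (g : R -> R) i j : measurable_fun setT g ->
  (forall x, 0 <= g x) -> \int[P]_w g (X i w) = \int[P]_w g (X j w).
Proof. by move=> mg g0; rewrite /Rintegral (ge0_integral_ident i j mg g0). Qed.

End identically_distributed.

Section claim_distribution.
Context (d : measure_display) (T : measurableType d) (R : realType).
Variable P : probability T R.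
Variable X : {RV P >-> R}.
Local Notation itg f := (P.-integrable setT (EFin \o f)).
Local Notation leb := (@lebesgue_measure R).

Lemma measurable_gt (Y : T -> R) (x : R) : measurable_fun setT Y ->
  measurable [set w | x < Y w].
Proof. by move=> mY; exact: measurable_ltr_set. Qed.

Lemma gt_preimage (Y : T -> R) (x : R) :
  [set w | x < Y w] = Y @^-1` `]x, +oo[%classic.
Proof. by apply/seteqP; split=> w /=; rewrite in_itv/= andbT. Qed.

Lemma tailE x : tail X x = pr P [set w | x < X w].
Proof.
rewrite /tail; have -> : [set w | x < X w] = ~` (X @^-1` `]-oo, x]).
  by apply/seteqP; split=> w /=; rewrite in_itv/= ltNge => /negP.
rewrite pr_setC//; exact: measurable_funPTI.
Qed.

Lemma tail_ge0 x : 0 <= tail X x.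
Proof. by rewrite tailE pr_ge0. Qed.

Lemma tail_le1 x : tail X x <= 1.
Proof. by rewrite tailE pr_le1//; exact: measurable_gt. Qed.

Lemma tail_ni x y : x <= y -> tail X y <= tail X x.
Proof.
move=> xy; rewrite !tailE; apply: pr_le; [exact: measurable_gt|exact: measurable_gt|].
by move=> w /=; exact: le_lt_trans.
Qed.

Lemma measurable_tail : measurable_fun setT (tail X).
Proof.
have -> : tail X = (fun x => fine (ccdf X x)).
  apply/funext => x; rewrite tailE /pr/ccdf/distribution/pushforward; congr (fine (P _)).
  exact: gt_preimage.
apply: measurableT_comp; first exact: fine_measurable.
exact: ccdf_measurable.
Qed.

End claim_distribution.

Section layer_cake.
Context (d : measure_display) (T : measurableType d) (R : realType).
Variable P : probability T R.
Local Notation itg f := (P.-integrable setT (EFin \o f)).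
Local Notation leb := (@lebesgue_measure R).

Lemma layer_cake (Y : T -> R) : measurable_fun setT Y -> (forall w, 0 <= Y w) ->
  itg Y ->
  leb.-integrable `[0, +oo[ (fun t => (pr P [set w | t < Y w])%:E) /\
  \int[leb]_(t in `[0, +oo[) pr P [set w | t < Y w] = \int[P]_w Y w.
Proof.
move=> mY Y0 iY.
pose Y' : {RV P >-> R} := mfun_Sub (mem_set mY : Y \in mfun).
have prE' t : (pr P [set w | t < Y w])%:E = ccdf Y' t.
  rewrite -prE; last exact: measurable_gt.
  by rewrite gt_preimage.
have cake := @ge0_expectation_ccdf _ _ _ P Y' Y0.
rewrite unlock in cake.
have fY := integrable_fin_num measurableT iY.
split.
  apply/integrableP; split.
    apply/measurable_EFinP; apply: measurable_funTS.
    have -> : (fun t => pr P [set w | t < Y w]) = (fun t => fine (ccdf Y' t)).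
      by apply/funext => t; rewrite -prE'.
    by apply: measurableT_comp; [exact: fine_measurable|exact: ccdf_measurable].
  under eq_integral do rewrite abse_EFin ger0_norm ?pr_ge0// prE'.
  by rewrite -cake -ge0_fin_numE//; apply: integral_ge0 => w _; rewrite lee_fin.
rewrite /Rintegral; under eq_integral do rewrite prE'.
by rewrite -cake.
Qed.

End layer_cake.

Section claim_integrals.
Context (d : measure_display) (T : measurableType d) (R : realType).
Variable P : probability T R.
Variable X : {RV P >-> R}.
Hypothesis X_ge0 : forall w, 0 <= X w.
Local Notation itg f := (P.-integrable setT (EFin \o f)).
Local Notation leb := (@lebesgue_measure R).
Hypothesis iX : itg X.

Let mXP : measurable_fun setT X. Proof. exact: measurable_funPT. Qed.

(** As a function of [t], [tail X (x + m * t)] is the tail of [(X - x)^+ / m]. *)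
Lemma tail_line_integral (m x : R) : 0 < m -> 0 < x ->
  leb.-integrable `[0, +oo[ (fun t => (tail X (x + m * t))%:E) /\
  \int[leb]_(t in `[0, +oo[) tail X (x + m * t) =
  m^-1 * \int[P]_w Num.max 0 (X w - x).
Proof.
move=> m0 x0; pose Y w := m^-1 * Num.max 0 (X w - x).
have mM : measurable_fun setT (fun w => Num.max 0 (X w - x)).
  by apply: measurable_maxr => //; exact: measurable_funB.
have iM : itg (fun w => Num.max 0 (X w - x)).
  apply: (@integrable_dom _ _ _ _ _ X) => // w.
  rewrite ger0_norm ?le_max ?lexx// ge_max X_ge0/=; lra.
have mY : measurable_fun setT Y by exact: measurable_funM.
have Y0 w : 0 <= Y w by rewrite mulr_ge0 ?invr_ge0 ?(ltW m0)// le_max lexx.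
have iY : itg Y by exact: integrableZR.
have E t : t \in (`[0, +oo[%classic : set R) -> tail X (x + m * t) = pr P [set w | t < Y w].
  rewrite inE/= in_itv/= andbT => t0; rewrite tailE; congr (pr P _).
  apply/seteqP; split=> w /=; rewrite /Y ltr_pdivlMl// lt_max.
    by move=> H; apply/orP; right; lra.
  by move=> /orP[|]; [rewrite ltNge mulr_ge0// ltW|lra].
have [i1 i2] := layer_cake mY Y0 iY; split.
  by apply: eq_integrable i1 => // t ti; rewrite E.
have -> : \int[leb]_(t in `[0, +oo[) tail X (x + m * t) =
    \int[leb]_(t in `[0, +oo[) pr P [set w | t < Y w].
  by apply: eq_Rintegral => t; exact: E.
by rewrite i2 /Y RintegralZl.
Qed.

(** The tail of [min X x] agrees with that of [X] below [x] and vanishes above. *)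
Lemma tail_head_integral (x : R) : 0 < x ->
  \int[leb]_(t in `[0, x]) tail X t = \int[P]_w Num.min (X w) x.
Proof.
move=> x0; pose Y w := Num.min (X w) x.
have mY : measurable_fun setT Y by exact: measurable_minr.
have Y0 w : 0 <= Y w by rewrite le_min X_ge0 ltW.
have iY : itg Y.
  by apply: (@integrable_dom _ _ _ _ _ X) => // w; rewrite ger0_norm// ge_min lexx.
have [i1 <-] := layer_cake mY Y0 iY.
have E t : t \in (`[0, x[%classic : set R) -> tail X t = pr P [set w | t < Y w].
  rewrite inE/= in_itv/= => /andP[_ tx]; rewrite tailE; congr (pr P _).
  by apply/seteqP; split=> w /=; rewrite /Y lt_min tx andbT.
have itvE : `[0, +oo[ `&` `[0, x[ = `[0, x[%classic :> set R.
  apply/seteqP; split=> t /=; rewrite !in_itv/= ?andbT; first by case.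
  by move=> /[dup] /andP[t0 _].
have i0 : leb.-integrable `[0, x[ (fun t => (pr P [set w | t < Y w])%:E).
  apply: integrableS i1 => //.
  by move=> t /=; rewrite !in_itv/= => /andP[->].
rewrite -Rintegral_itv_bndo_bndc; last by apply: eq_integrable i0 => // t ti; rewrite /= E.
have -> : \int[leb]_(t in `[0, x[) tail X t = \int[leb]_(t in `[0, x[) pr P [set w | t < Y w].
  by apply: eq_Rintegral => t; exact: E.
rewrite -[in LHS]itvE Rintegral_mkcondr; apply: eq_Rintegral => t.
rewrite inE/= in_itv/= andbT => t0; rewrite patchE.
case: ifPn => //; rewrite notin_setE/= in_itv/= t0/= => /negP; rewrite -leNgt => xt.
rewrite -[LHS](pr_set0 P); congr (pr P _); apply/seteqP; split => // w /=.
by rewrite /Y lt_min => /andP[_]; rewrite ltNge xt.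
Qed.

(** Both sides are the stop-loss transform [E (X - x)^+] divided by [m], since
    [X = min X x + (X - x)^+]. *)
Lemma tail_line_integralE (mu m x : R) : 0 < mu -> \int[P]_w X w = 1 / mu ->
  0 < m -> 0 < x ->
  \int[leb]_(t in `[0, +oo[) tail X (x + m * t) =
  1 / (m * mu) * (1 - integrated_tail mu (tail X) x).
Proof.
move=> mu0 EX m0 x0; have [_ ->] := tail_line_integral m0 x0.
rewrite /integrated_tail tail_head_integral//.
have mM : measurable_fun setT (fun w => Num.max 0 (X w - x)).
  by apply: measurable_maxr => //; exact: measurable_funB.
have iM : itg (fun w => Num.max 0 (X w - x)).
  apply: (@integrable_dom _ _ _ _ _ X) => // w.
  rewrite ger0_norm ?le_max ?lexx// ge_max X_ge0/=; lra.
have mm : measurable_fun setT (fun w => Num.min (X w) x) by exact: measurable_minr.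
have im : itg (fun w => Num.min (X w) x).
  apply: (@integrable_dom _ _ _ _ _ X) => // w.
  by rewrite ger0_norm ?ge_min ?lexx// le_min X_ge0 ltW.
have : \int[P]_w X w = (\int[P]_w Num.min (X w) x) + \int[P]_w Num.max 0 (X w - x).
  rewrite -RintegralD//; apply: eq_Rintegral => w _.
  by case: (leP (X w) x) => Xx; [rewrite max_l|rewrite max_r]; lra.
rewrite EX => H; have -> : \int[P]_w Num.max 0 (X w - x) =
  1 / mu - \int[P]_w Num.min (X w) x by lra.
by field; rewrite !gt_eqF.
Qed.

Definition truncate (y x : R) : R := if x <= y then x else 0.

Lemma measurable_truncate y : measurable_fun setT (truncate y).
Proof.
apply: measurable_fun_ifT => //; exact: measurable_fun_ler.
Qed.

Lemma truncate_ge0 y x : 0 <= x -> 0 <= truncate y x.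
Proof. by rewrite /truncate; case: ifP. Qed.

Lemma truncate_le y x : 0 <= x -> truncate y x <= x.
Proof. by rewrite /truncate; case: ifP. Qed.

Lemma truncate_le_bound y x : 0 <= y -> truncate y x <= y.
Proof. by rewrite /truncate; case: ifP. Qed.

Let mtr y : measurable_fun setT (fun w => truncate y (X w)).
Proof. by apply: measurableT_comp => //; exact: measurable_truncate. Qed.

Lemma integrable_truncate y : itg (fun w => truncate y (X w)).
Proof.
apply: (@integrable_dom _ _ _ _ _ X) => // w.
by rewrite ger0_norm ?truncate_ge0// truncate_le.
Qed.

Lemma integrable_truncate2 y : 0 <= y -> itg (fun w => truncate y (X w) ^+ 2).
Proof.
move=> y0; apply: (@integrable_dom _ _ _ _ _ (fun=> y ^+ 2)) => //.
- exact: measurable_funX.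
- move=> w; rewrite ger0_norm ?sqr_ge0// lerXn2r ?nnegrE ?truncate_ge0//.
  exact: truncate_le_bound.
- exact: integrable_cstP.
Qed.

Lemma truncate_mean_le y : \int[P]_w truncate y (X w) <= \int[P]_w X w.
Proof.
apply: le_Rintegral => //; first exact: integrable_truncate.
by move=> w _; exact: truncate_le.
Qed.

Lemma truncate_mean_cvg (eps : R) : 0 < eps -> exists2 y0 : R, 0 < y0 &
  forall y, y0 <= y -> \int[P]_w X w - eps <= \int[P]_w truncate y (X w).
Proof.
move=> e0.
have mono y z : y <= z -> \int[P]_w truncate y (X w) <= \int[P]_w truncate z (X w).
  move=> yz; apply: le_Rintegral => //; try exact: integrable_truncate.
  move=> w _; rewrite /truncate; case: ifP => Xy; first by rewrite (le_trans Xy yz).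
  by case: ifP.
have dct : (fun n => \int[P]_w (truncate n%:R (X w))%:E)%E @ \oo --> (\int[P]_w (X w)%:E)%E.
  have := @dominated_convergence _ _ _ P setT measurableT
    (fun n w => (truncate n%:R (X w))%:E) (EFin \o X) (EFin \o X).
  case => //.
  - by move=> n; apply/measurable_EFinP; exact: mtr.
  - exact/measurable_EFinP.
  - apply: aeW => w _; apply: cvg_near_cst.
    near=> n; rewrite /truncate ifT//.
    near: n; exact: nbhs_infty_ger.
  - apply: aeW => w n _ /=; rewrite lee_fin ger0_norm ?truncate_ge0//.
    exact: truncate_le.
have fX := integrable_fin_num measurableT iX.
have : (fun n => \int[P]_w truncate n%:R (X w)) @ \oo --> \int[P]_w X w.
  by apply: fine_cvg; rewrite fineK.
move=> /cvgrPdist_le /(_ _ e0)[N _ HN].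
exists (N%:R + 1); first by rewrite ltr_wpDl.
move=> y Ny; have := HN N (leqnn N); rewrite /= ler_distlC => /andP[+ _].
move/le_trans; apply; apply: mono; lra.
Unshelve. all: by end_near.
Qed.

(** Doubling the truncation level from [z] to [y = 2 * z] adds at most
    [y ^+ 2 * tail X z], of order [z `^ (2 - alpha)], to the second moment. Since
    [alpha < 2] the increments form a geometric series dominated by the last. *)
Lemma truncate_second_moment (C alpha : R) : 0 < C -> 1 < alpha -> alpha < 2 ->
  (forall x : R, 0 < x -> tail X x <= C * x `^ (- alpha)) ->
  exists2 C' : R, 0 < C' & forall y : R, 1 <= y ->
    \int[P]_w (truncate y (X w) ^+ 2) <= C' * y `^ (2 - alpha).
Proof.
move=> C0 al1 al2 tC; pose s : R := 2 - alpha; have s0 : 0 < s by rewrite /s; lra.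
have p2 : 1 < 2 `^ s.
  have := @gt0_ltr_powR _ s s0 1 2; rewrite powR1; apply; rewrite ?nnegrE//.
  by rewrite ltr1n.
(* [C1] is large enough for [C1 * (2 `^ s - 1)] to absorb the increment *)
pose C1 := 4 + 4 * C / (2 `^ s - 1).
have C10 : 4 <= C1 by rewrite lerDl divr_ge0//; lra.
have C1E : 4 * C <= C1 * (2 `^ s - 1).
  have D0 : 0 < 2 `^ s - 1 by lra.
  have e : 4 * C / (2 `^ s - 1) * (2 `^ s - 1) = 4 * C by rewrite divfK// gt_eqF.
  by rewrite /C1 [leRHS]mulrDl e; lra.
exists C1; first lra.
have ps_ge1 y : 1 <= y -> 1 <= y `^ s.
  move=> y1; have <- : 1 `^ s = 1 :> R by rewrite powR1.
  by apply: ge0_ler_powR; rewrite ?nnegrE; lra.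
have base y : 1 <= y -> y <= 2 -> \int[P]_w (truncate y (X w) ^+ 2) <= C1 * y `^ s.
  move=> y1 y2; have y0 : 0 <= y by lra.
  apply: (@le_trans _ _ (y ^+ 2)).
    rewrite -[leRHS](Rintegral_cstP P); apply: le_Rintegral => //.
    - exact: integrable_truncate2.
    - exact: integrable_cstP.
    - move=> w _; rewrite lerXn2r ?nnegrE ?truncate_ge0//.
      exact: truncate_le_bound.
  have := ps_ge1 y y1; rewrite expr2; nra.
have H n : forall y, 1 <= y -> y <= 2 ^+ n ->
    \int[P]_w (truncate y (X w) ^+ 2) <= C1 * y `^ s.
  elim: n => [|n IH] y y1 yn; first by apply: base => //; rewrite expr0 in yn; lra.
  have [y2|y2] := leP y 2; first exact: base.
  pose z := y / 2; have yz : y = 2 * z by rewrite /z; field.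
  have z1 : 1 <= z by lra.
  have zn : z <= 2 ^+ n by move: yn; rewrite exprS; lra.
  have z0 : 0 < z by lra.
  have mI : measurable [set w | z < X w] by exact: measurable_gt.
  have iI : itg (\1_[set w | z < X w] : T -> R).
    apply: (@integrable_dom _ _ _ _ _ (fun=> 1)) => //.
    - by move=> w; rewrite indicE; case: (w \in _); rewrite /= ?normr1 ?normr0.
    - exact: integrable_cstP.
  have step : \int[P]_w (truncate y (X w) ^+ 2) <=
      \int[P]_w (truncate z (X w) ^+ 2) + y ^+ 2 * tail X z.
    rewrite tailE -(Rintegral_pr P mI) -RintegralZl// -RintegralD//; last 2 first.
    - by apply: integrable_truncate2; lra.
    - exact: integrableZR.
    apply: le_Rintegral => //.
    - by apply: integrable_truncate2; lra.
    - by apply: integrableDR; [apply: integrable_truncate2; lra|exact: integrableZR].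
    - move=> w _; rewrite indicE /truncate; have := X_ge0 w.
      case: (leP (X w) z) => Xz.
        have -> : X w <= y by lra.
        rewrite memNset/= ?mulr0 ?addr0//= => /(le_lt_trans Xz).
        by rewrite ltxx.
      rewrite mem_set//= mulr1 expr0n/= add0r; case: ifP => Xy X0.
        by rewrite lerXn2r ?nnegrE//; lra.
      by rewrite expr0n/= sqr_ge0.
  apply: (le_trans step).
  have E : y ^+ 2 * z `^ (- alpha) = 4 * z `^ s.
    have -> : s = 2%:R + - alpha by rewrite /s.
    rewrite powRD ?(gt_eqF z0) ?implybT// powR_mulrn ?(ltW z0)// yz; ring.
  have E2 : y `^ s = 2 `^ s * z `^ s by rewrite yz powRM// ltW.
  have zs : 0 < z `^ s by exact: powR_gt0.
  have t1 : y ^+ 2 * tail X z <= 4 * C * z `^ s.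
    apply: (le_trans (ler_wpM2l (sqr_ge0 y) (tC z z0))).
    by rewrite mulrCA E; lra.
  have := IH z z1 zn; rewrite E2.
  have := ler_wpM2r (ltW zs) C1E; lra.
move=> y y1; apply: (H (Num.truncn y).+1) => //.
apply: (@le_trans _ _ (Num.truncn y).+1%:R); first by rewrite ltW// truncnS_gt.
by rewrite -natrX ler_nat ltnW// ltn_expl.
Qed.

End claim_integrals.

(** * Tail integrals along linearly growing profiles *)

Section profile.
Context (R : realType).
Variables (F : R -> R) (A alpha : R).
Hypothesis A_gt0 : 0 < A.
Hypothesis alpha_gt1 : 1 < alpha.
Hypothesis F_asymp : asymp_equiv F (fun x => A * x `^ (- alpha)).
Hypothesis F_ge0 : forall x, 0 <= F x.
Hypothesis F_le1 : forall x, F x <= 1.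
Hypothesis F_ni : forall x y, x <= y -> F y <= F x.
Hypothesis mF : measurable_fun setT F.
Local Notation leb := (@lebesgue_measure R).

Lemma powRN_small (s e : R) : 0 < s -> 0 < e ->
  exists2 K0 : R, 2 <= K0 & forall K : R, K0 <= K -> K `^ (- s) <= e.
Proof.
move=> s0 e0; have sn0 : - s != 0 by rewrite oppr_eq0 gt_eqF.
have [t t0 tE] := @powR_inv_root _ (- s) e sn0 e0.
exists (Num.max 2 t); first by rewrite le_max lexx.
move=> K; rewrite ge_max => /andP[_ tK].
have := tE 1 ler01; rewrite mulr1 powR1 mulr1 => <-.
by apply: powRN_le => //; exact: ltW.
Qed.

(** The properties shared by the minimum and the maximum of the two drifted
    lines; [c0] and [c1] do not depend on [K]. *)
Definition linear_profile (c0 c1 K : R) (f : R -> R) :=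
  [/\ measurable_fun setT f, forall x y : R, 0 <= x -> x <= y -> f x <= f y &
      forall t : R, 0 <= t -> c0 * (t + K) <= f t <= c1 * (t + K)].

Definition profile_integral (f : R -> R) := \int[leb]_(t in `[0, +oo[) F (f t).

Lemma profile_sum_le (c0 : R) : 0 < c0 -> exists2 C : R, 0 < C &
  forall (K c : R) (g : R -> R), 2 <= K -> c0 <= c ->
    (forall i : nat, c * (i%:R + K) <= g i%:R) ->
    forall N, \sum_(i < N) F (g i%:R) <= C * K `^ (1 - alpha).
Proof.
move=> c00; have [C C0 FC] := tail_upper A_gt0 alpha_gt1 F_asymp F_le1.
have D0 : 0 < (alpha - 1)^-1 * 2 `^ (alpha - 1).
  by rewrite mulr_gt0 ?invr_gt0 ?powR_gt0//; have := alpha_gt1; lra.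
exists (C * c0 `^ (- alpha) * ((alpha - 1)^-1 * 2 `^ (alpha - 1))).
  by rewrite mulr_gt0 ?D0// mulr_gt0 ?powR_gt0.
move=> K c g K2 cc gc N; rewrite -mulrA.
apply: le_trans (ler_wpM2l _ (@powR_sum_le _ alpha K N alpha_gt1 K2)); last first.
  by rewrite mulr_ge0 ?powR_ge0// ltW.
rewrite mulr_sumr; apply: ler_sum => i _.
have iK : 0 < i%:R + K by rewrite ltr_wpDl//; lra.
have ciK : 0 < c0 * (i%:R + K) by exact: mulr_gt0.
apply: (@le_trans _ _ (F (c0 * (i%:R + K)))).
  by apply: F_ni; apply: le_trans (gc i); rewrite ler_pM2r.
by rewrite -mulrA -powRM; [exact: FC|exact: ltW|exact: ltW].
Qed.

(** The first [K] values of [F (f t)] are of order [K `^ (- alpha)] and give the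
    integral the order [K `^ (1 - alpha)]; a single value is negligible against
    it, which makes sums over the integers interchangeable with the integral. *)
Lemma profile_estimates (c0 c1 : R) : 0 < c0 -> 0 < c1 ->
  exists c C K0 : R, [/\ 0 < c, 0 < C, 2 <= K0 &
  forall (K : R) (f : R -> R), K0 <= K -> linear_profile c0 c1 K f ->
  [/\ leb.-integrable `[0, +oo[ (fun t => (F (f t))%:E),
      c * K `^ (1 - alpha) <= profile_integral f,
      F (f 0) <= C * K `^ (- alpha),
      forall N, \sum_(i < N) F (f i%:R) <= F (f 0) + profile_integral f &
      forall x : R, x < profile_integral f -> exists N, x < \sum_(i < N) F (f i%:R)]].
Proof.
move=> c00 c10; have [C C0 sumC] := profile_sum_le c00.
have [C' C'0 FC] := tail_upper A_gt0 alpha_gt1 F_asymp F_le1.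
have [cl cl0 [x0 x00 Fl]] := tail_lower A_gt0 F_asymp.
exists (cl * (3 * c1) `^ (- alpha)), (C' * c0 `^ (- alpha)), (Num.max 2 (x0 / c0)).
have p3 : 0 < (3 * c1) `^ (- alpha) by rewrite powR_gt0// mulr_gt0.
split; [exact: mulr_gt0|by rewrite mulr_gt0 ?powR_gt0|by rewrite le_max lexx|].
move=> K f; rewrite ge_max => /andP[K2 Kx] [mf f_nd fb].
have K0 : 0 < K by lra.
have h_ge0 x : 0 <= F (f x) by [].
have mh : measurable_fun setT (fun t => F (f t)) by exact: measurableT_comp.
have h_ni x y : 0 <= x -> x <= y -> F (f y) <= F (f x).
  by move=> x1 xy; apply: F_ni; exact: f_nd.
have [ih _] := @integrable_of_sum R (fun t => F (f t)) h_ge0 mh h_ni _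
  (sumC K c0 f K2 (lexx _) (fun i => proj1 (andP (fb i%:R (ler0n _ i))))).
have lower N := @sum_le_integral R (fun t => F (f t)) h_ge0 mh h_ni N ih.
split => //.
- pose N := (Num.truncn K).+1.
  have KN : K <= N%:R by rewrite ltW// truncnS_gt.
  have NK : N%:R <= 2 * K.
    have tK : (Num.truncn K)%:R <= K by rewrite truncn_le ltW.
    by rewrite /N -natr1; lra.
  apply: le_trans (lower N); apply: (@le_trans _ _ (\sum_(i < N) F (f N%:R))).
    rewrite sumr_const card_ord.
    have fN : f N%:R <= 3 * c1 * K.
      by have /andP[_] := fb N%:R (ler0n _ N); nra.
    have fN0 : x0 <= 3 * c1 * K.
      apply: le_trans fN; have /andP[+ _] := fb N%:R (ler0n _ N); apply: le_trans.
      by move: Kx; rewrite ler_pdivrMr//; nra.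
    apply: (@le_trans _ _ (F (f N%:R) * K)); last first.
      by rewrite -[leRHS]mulr_natr ler_wpM2l.
    apply: (@le_trans _ _ (F (3 * c1 * K) * K)); last by rewrite ler_pM2r// F_ni.
    apply: (@le_trans _ _ (cl * (3 * c1 * K) `^ (- alpha) * K)); last first.
      by rewrite ler_pM2r//; exact: Fl.
    have c13 : 0 <= 3 * c1 by rewrite mulr_ge0 ?(ltW c10).
    rewrite (powRM _ c13 (ltW K0)).
    have -> : K `^ (1 - alpha) = K * K `^ (- alpha).
      by rewrite powRD ?(gt_eqF K0) ?implybT// powRr1// ltW.
    by rewrite le_eqVlt; apply/orP; left; apply/eqP; ring.
  apply: ler_sum => i _; apply: h_ni; first by [].
  by rewrite ler_nat ltn_ord.
- have /andP[f0 _] := fb 0 (lexx 0); rewrite add0r in f0.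
  rewrite -mulrA -powRM ?(ltW c00) ?(ltW K0)//.
  have cK : 0 < c0 * K by exact: mulr_gt0.
  by apply: le_trans (FC _ cK); exact: F_ni.
- move=> N; case: N => [|N]; first by rewrite big_ord0 addr_ge0// Rintegral_ge0.
  by rewrite big_ord_recl lerD2l; exact: lower.
- move=> x xI; apply: contrapT => /forallNP H.
  have Hx N : \sum_(i < N) F (f i%:R) <= x by rewrite leNgt; apply/negP; exact: H.
  have [_] := @integrable_of_sum R (fun t => F (f t)) h_ge0 mh h_ni x Hx.
  by rewrite leNgt xI.
Qed.

End profile.

(** * Two rare independent events *)

Section pairwise.
Context (d : measure_display) (T : measurableType d) (R : realType).
Variable P : probability T R.

Lemma independent_pair (X : nat -> T -> R) : (forall i, measurable_fun setT (X i)) ->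
  mutually_independent P X -> forall i j B C, i != j ->
  measurable B -> measurable C ->
  pr P (X i @^-1` B `&` X j @^-1` C) = pr P (X i @^-1` B) * pr P (X j @^-1` C).
Proof.
move=> mX iX i j B C ij mB mC.
have mXB k D : measurable D -> measurable (X k @^-1` D).
  by move=> mD; rewrite -[_ @^-1` _]setTI; exact: mX.
have := iX [:: i; j] (fun k => if k == i then B else C).
rewrite /= inE ij => /(_ isT).
rewrite !big_cons !big_nil eqxx eq_sym (negbTE ij) setIT mule1.
have mBC : forall k : nat, measurable (if k == i then B else C) by move=> k; case: ifP.
move=> /(_ mBC).
rewrite (prE P (mXB i B mB)) (prE P (mXB j C mC)).
rewrite (prE P (measurableI _ _ (mXB i B mB) (mXB j C mC))) -EFinM.
exact: EFin_inj.
Qed.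

(** Union bound over the pairs, whose probabilities sum to at most
    [s * s]. *)
Lemma pr_two_events (A : nat -> set T) (s : R) : (forall n, measurable (A n)) ->
  (forall i j, (i < j)%N -> pr P (A i `&` A j) = pr P (A i) * pr P (A j)) ->
  (forall N, \sum_(n < N) pr P (A n) <= s) ->
  pr P [set w | exists i j, [/\ (i < j)%N, A i w & A j w]] <= s ^+ 2.
Proof.
move=> mA iA As.
have s0 : 0 <= s by have := As 0%N; rewrite big_ord0.
pose B j := \big[setU/set0]_(i < j) (A i `&` A j).
have mB j : measurable (B j).
  by apply: bigsetU_measurable => i _; exact: measurableI.
have -> : [set w | exists i j, [/\ (i < j)%N, A i w & A j w]] = \bigcup_j B j.
  apply/seteqP; split=> w.
    move=> [i [j [ij Ai Aj]]]; exists j => //.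
    by rewrite /B -(bigcup_mkord j (fun i => A i `&` A j)); exists i.
  move=> [j _]; rewrite /B -(bigcup_mkord j (fun i => A i `&` A j)).
  by move=> [i /= ij [Ai Aj]]; exists i, j.
have Bs j : pr P (B j) <= s * pr P (A j).
  apply: (@le_trans _ _ (\sum_(i < j) pr P (A i `&` A j))).
    by apply: (@pr_bigsetU_le _ _ _ P (fun i => A i `&` A j)) => i; exact: measurableI.
  have -> : \sum_(i < j) pr P (A i `&` A j) = \sum_(i < j) pr P (A i) * pr P (A j).
    by apply: eq_bigr => i _; rewrite iA.
  by rewrite -mulr_suml ler_wpM2r ?pr_ge0.
apply: pr_bigcup_le => // N; apply: (@le_trans _ _ (\sum_(j < N) s * pr P (A j))).
  exact: ler_sum.
by rewrite -mulr_sumr expr2 ler_wpM2l.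
Qed.
End pairwise.

(** * Moments of the model variables *)

Section moments.
Context (d : measure_display) (T : measurableType d) (R : realType).
Variable P : probability T R.

Lemma integrable_of_mean (Y : T -> R) (c : R) : measurable_fun setT Y ->
  (forall w, 0 <= Y w) -> ('E_P[Y] = c%:E)%E ->
  P.-integrable setT (EFin \o Y) /\ \int[P]_w Y w = c.
Proof.
rewrite unlock => mY Y0 EY; split; last by rewrite /Rintegral EY.
apply/integrableP; split; first exact/measurable_EFinP.
under eq_integral do rewrite /= ger0_norm//.
by rewrite EY ltry.
Qed.

Lemma mean_ident (X : nat -> {RV P >-> R}) (c : R) : (forall i w, 0 <= X i w) ->
  identically_distributed P X -> ('E_P[X 0%N] = c%:E)%E ->
  forall i, P.-integrable setT (EFin \o X i) /\ \int[P]_w X i w = c.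
Proof.
move=> X0 idX EX i.
have [i0 E0] := integrable_of_mean (measurable_funPT (X 0%N)) (X0 0%N) EX.
have E k w : X k w = `|X k w| by rewrite ger0_norm.
have mn : measurable_fun setT (fun x : R => `|x|) by exact: normr_measurable.
split.
  apply: (eq_integrable _ (fun w => `|X i w|%:E)) => //.
    by move=> w _; rewrite /= -E.
  apply: (@integrable_ident _ _ _ P X idX (fun x => `|x|) 0 i mn) => //.
  by apply: eq_integrable i0 => // w _; rewrite /= -E.
rewrite -E0; under eq_Rintegral do rewrite E.
under [RHS]eq_Rintegral do rewrite E.
exact: (Rintegral_ident idX (g := fun x => `|x|)).
Qed.

Lemma centered_second_moment (Y : T -> R) : measurable_fun setT Y ->
  P.-integrable setT (EFin \o Y) ->
  P.-integrable setT (EFin \o (fun w => Y w ^+ 2)) ->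
  let c := \int[P]_w Y w in
  [/\ P.-integrable setT (EFin \o (fun w => (Y w - c) ^+ 2)),
      \int[P]_w (Y w - c) = 0 &
      \int[P]_w ((Y w - c) ^+ 2) <= \int[P]_w (Y w ^+ 2)].
Proof.
move=> mY iY iY2 c.
have ilin : P.-integrable setT (EFin \o (fun w => - (2 * c) * Y w + c ^+ 2)).
  by apply: integrableDR; [exact: integrableZR|exact: integrable_cstP].
have E w : (Y w - c) ^+ 2 = Y w ^+ 2 + (- (2 * c) * Y w + c ^+ 2) by ring.
split.
- apply: (eq_integrable _ (fun w => (Y w ^+ 2 + (- (2 * c) * Y w + c ^+ 2))%:E)) => //.
    by move=> w _; rewrite /= E.
  exact: integrableDR.
- by rewrite RintegralB ?Rintegral_cstP ?subrr//; exact: integrable_cstP.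
- under eq_Rintegral do rewrite E.
  rewrite RintegralD// RintegralD//; last 2 first.
  + exact: integrableZR.
  + exact: integrable_cstP.
  rewrite RintegralZl// Rintegral_cstP -/c.
  by have := sqr_ge0 c; rewrite expr2; lra.
Qed.
End moments.

(** * Ruin and large jumps along a path *)

Section sample_paths.
Context (T : Type) (R : realType).
Variables zeta sigma : nat -> T -> R.
Variables (lambda mu dl eta K : R).
Variable w : T.
Local Notation level i := (dl * (i%:R + K)).
Local Notation St n := (\sum_(i < n) truncate (level i) (sigma i w)).

(** The arrival times and the truncated claims follow their means up to
    [eta * (n + K)], so what is missing for the crossing at [n] must come from the
    only claim above its truncation level. Its index precedes [n], where the
    drifted line [x + m * t] is lower. *)
Lemma large_jump_of_crossing (th p x : R) n :
  let m := p * (1 / lambda) - 1 / mu in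
  0 < p -> 0 <= m -> 0 < x -> 0 <= th ->
  (forall n : nat, n%:R / lambda - eta * (n%:R + K) <= arrival_time zeta n w) ->
  (forall n : nat, St n <= n%:R / mu + eta * (n%:R + K)) ->
  (forall i j, level i < sigma i w -> level j < sigma j w -> i = j) ->
  (forall n : nat, (p + 1) * eta * (n%:R + K) <= (1 - th) * (x + m * n%:R)) ->
  x + p * arrival_time zeta n w < claim_sum sigma n w ->
  exists i, level i < sigma i w /\ th * (x + m * i%:R) < sigma i w.
Proof.
move=> m p0 m0 x0 th0 hT hS hU hc cr.
have gap : th * (x + m * n%:R) < \sum_(i < n) (sigma i w - truncate (level i) (sigma i w)).
  rewrite sumrB -/(claim_sum sigma n w) ltrBrDr.
  apply: le_lt_trans cr.
  have := ler_wpM2l (ltW p0) (hT n); have := hS n; have := hc n.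
  have -> : m * n%:R = p * (n%:R / lambda) - n%:R / mu.
    by rewrite /m mulrBl !mul1r [n%:R / lambda]mulrC mulrA [n%:R / mu]mulrC.
  lra.
have small i : ~ level i < sigma i w -> sigma i w - truncate (level i) (sigma i w) = 0.
  by move/negP; rewrite -leNgt /truncate => ->; rewrite subrr.
have [[i lev_i]|none] := pselect (exists i : 'I_n, level i < sigma i w); last first.
  move: gap; rewrite big1; last first.
    by move=> i _; apply: small => li; apply: none; exists i.
  by rewrite ltNge mulr_ge0// addr_ge0 ?mulr_ge0// ltW.
exists i; split => //; apply: (@le_lt_trans _ _ (th * (x + m * n%:R))).
  apply: ler_wpM2l => //; rewrite lerD2l; apply: ler_wpM2l => //.
  by rewrite ler_nat ltnW.
move: gap; rewrite (bigD1 i)//= big1 ?addr0.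
  by move=> ji; rewrite /truncate leNgt lev_i/= subr0 in ji.
move=> j ji; apply: small => lj; move/eqP: ji; apply; apply: val_inj.
exact: hU.
Qed.

Lemma crossing_of_large_jump (th p x : R) i :
  let m := p * (1 / lambda) - 1 / mu in
  0 < p ->
  arrival_time zeta i.+1 w <= i.+1%:R / lambda + eta * (i.+1%:R + K) ->
  i%:R / mu - 2 * eta * (i%:R + K) <= St i -> St i <= claim_sum sigma i w ->
  p / lambda + (p * eta * (i%:R + 1 + K) + 2 * eta * (i%:R + K)) <=
    (th - 1) * (x + m * i%:R) ->
  th * (x + m * i%:R) < sigma i w ->
  x + p * arrival_time zeta i.+1 w < claim_sum sigma i.+1 w.
Proof.
move=> m p0 hT hS hS' hc jump.
rewrite /claim_sum big_ord_recr/= -/(claim_sum sigma i w).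
have := ler_wpM2l (ltW p0) hT.
rewrite -natr1.
have -> : p * ((i%:R + 1) / lambda + eta * (i%:R + 1 + K)) =
    p / lambda + p * (i%:R / lambda) + p * eta * (i%:R + 1 + K) by ring.
have : m * i%:R = p * (i%:R / lambda) - i%:R / mu.
  by rewrite /m mulrBl !mul1r [i%:R / lambda]mulrC mulrA [i%:R / mu]mulrC.
move=> mE hpT; move: hc jump; lra.
Qed.

End sample_paths.

(** * Exceptional events *)

Section model.
Context (d : measure_display) (T : measurableType d) (R : realType).
Variable P : probability T R.
Variables (zeta sigma : nat -> {RV P >-> R}).
Variables (lambda mu A alpha : R).
Hypothesis zeta_ge0 : forall i w, 0 <= zeta i w.
Hypothesis sigma_ge0 : forall i w, 0 <= sigma i w.
Hypothesis zeta_iid : iid P zeta.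
Hypothesis sigma_iid : iid P sigma.
Hypothesis zeta_sigma_indep : independent_sequences P zeta sigma.
Hypothesis lambda_gt0 : 0 < lambda.
Hypothesis mu_gt0 : 0 < mu.
Hypothesis zeta_mean : ('E_P[zeta 0%N] = (1 / lambda)%:E)%E.
Hypothesis sigma_mean : ('E_P[sigma 0%N] = (1 / mu)%:E)%E.
Hypothesis zeta_moment3 : ('E_P[fun w => (zeta 0%N w ^+ 3)%R] < +oo)%E.
Hypothesis A_gt0 : 0 < A.
Hypothesis alpha_gt1 : (1 < alpha)%R.
Hypothesis alpha_lt2 : (alpha < 2)%R.
Hypothesis sigma_tail :
  asymp_equiv (tail (sigma 0%N)) (fun x => A * x `^ (- alpha)).

Local Notation itg f := (P.-integrable setT (EFin \o f)).
Local Notation F := (tail (sigma 0%N)).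

Let mzeta i : measurable_fun setT (zeta i : T -> R).
Proof. exact: measurable_funPT. Qed.
Let msigma i : measurable_fun setT (sigma i : T -> R).
Proof. exact: measurable_funPT. Qed.

Let izeta i : itg (zeta i) /\ \int[P]_w zeta i w = 1 / lambda.
Proof. exact: mean_ident zeta_iid.2 zeta_mean i. Qed.

Let isigma i : itg (sigma i) /\ \int[P]_w sigma i w = 1 / mu.
Proof. exact: mean_ident sigma_iid.2 sigma_mean i. Qed.

Let izeta2 i : itg (fun w => zeta i w ^+ 2).
Proof.
have m2 : measurable_fun setT (fun x : R => x ^+ 2) by exact: measurable_funX.
apply: (@integrable_ident _ _ _ P zeta zeta_iid.2 (fun x => x ^+ 2) 0 i m2).
  by move=> x; exact: sqr_ge0.
have i3 : itg (fun w => zeta 0%N w ^+ 3).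
  apply/integrableP; split.
    by apply/measurable_EFinP; exact: measurable_funX.
  under eq_integral do rewrite /= ger0_norm ?exprn_ge0//.
  by move: zeta_moment3; rewrite unlock.
apply: (@integrable_dom _ _ _ _ _ (fun w => 1 + zeta 0%N w ^+ 3)).
- exact: measurable_funX.
- move=> w; rewrite ger0_norm ?sqr_ge0//; have := zeta_ge0 0 w.
  set x := zeta _ w; rewrite !exprS expr0 mulr1 => x0.
  have [x1|x1] := leP x 1; first by have := mulr_ge0 x0 (mulr_ge0 x0 x0); nra.
  by have := mulr_ge0 x0 x0; nra.
- by apply: integrableDR => //; exact: integrable_cstP.
Qed.

Lemma tail_ident i x : pr P [set w | x < sigma i w] = F x.
Proof.
rewrite tailE /pr; congr fine.
by rewrite !gt_preimage; apply: sigma_iid.2.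
Qed.

Definition arrival_bad (eta K : R) : set T :=
  [set w | exists n : nat,
    eta * (n%:R + K) < `|\sum_(i < n.+1) (zeta i w - 1 / lambda)|].

(** With finite variance the maximal inequality gives [O (1 / K)], negligible
    against [K `^ (1 - alpha)] because [alpha < 2]. *)
Lemma arrival_bad_small (eta : R) : 0 < eta -> exists2 C : R, 0 < C &
  forall K : R, 2 <= K -> pr P (arrival_bad eta K) <= C * K^-1.
Proof.
move=> eta0.
pose V := \int[P]_w ((zeta 0%N w - 1 / lambda) ^+ 2).
have V0 : 0 <= V by apply: Rintegral_ge0 => w _; exact: sqr_ge0.
exists ((V + 1) / eta ^+ 2 * 2).
  by rewrite mulr_gt0// divr_gt0 ?exprn_gt0// ltr_wpDl.
move=> K K2.
have iK i : 0 < i%:R + K by rewrite ltr_wpDl//; lra.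
apply: (@hajek_renyi _ _ _ P zeta mzeta zeta_iid.1 (fun i x => x - 1 / lambda) _
  (fun=> V + 1) (fun n => eta * (n%:R + K))).
- by move=> i; exact: measurable_funB.
- move=> i; apply: (@integrable_dom _ _ _ _ _
    (fun w => 2 * zeta i w ^+ 2 + 2 * (1 / lambda) ^+ 2)).
  + by apply: measurable_funX; exact: measurable_funB.
  + move=> w; rewrite ger0_norm ?sqr_ge0//.
    by have := sqr_ge0 (zeta i w + 1 / lambda); nra.
  + by apply: integrableDR; [exact: integrableZR|exact: integrable_cstP].
- move=> i; have [i1 i2] := izeta i.
  by rewrite RintegralB// ?i2 ?Rintegral_cstP ?subrr//; exact: integrable_cstP.
- move=> i; rewrite (Rintegral_ident zeta_iid.2 i 0 (g := fun x => (x - 1 / lambda) ^+ 2)).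
  + by rewrite -/V lerDl.
  + by apply: measurable_funX; exact: measurable_funB.
  + by move=> x; exact: sqr_ge0.
- by move=> i; exact: mulr_gt0.
- by move=> i; rewrite ler_pM2l// lerD2r ler_nat.
- move=> N; apply: (@le_trans _ _ (\sum_(k < N) (V + 1) / eta ^+ 2 * (k%:R + K) `^ (- 2))).
    apply: ler_sum => k _; rewrite powRN (powR_mulrn 2) ?(ltW (iK k))//.
    by rewrite le_eqVlt; apply/orP; left; apply/eqP; field; rewrite !gt_eqF.
  rewrite -mulr_sumr -[leRHS]mulrA ler_pM2l; last first.
    by rewrite divr_gt0 ?exprn_gt0 ?ltr_wpDl.
  have := @powR_sum_le R 2 K N ltac:(lra) K2.
  have -> : (2 - 1)^-1 * 2 `^ (2 - 1) * K `^ (1 - 2) = 2 * K^-1 :> R.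
    have -> : 2 - 1 = 1 :> R by ring.
    have -> : 1 - 2 = -1 :> R by ring.
    by rewrite invr1 mul1r powRr1// powR_inv1//; lra.
  exact.
Qed.


Local Notation level dl K i := (dl * (i%:R + K)).

Definition truncated_claims (dl K : R) (n : nat) (w : T) : R :=
  \sum_(i < n) truncate (level dl K i) (sigma i w).

Definition truncated_mean (dl K : R) (i : nat) : R :=
  \int[P]_w truncate (level dl K i) (sigma 0%N w).

Definition claim_bad (dl eta K : R) : set T :=
  [set w | exists n : nat, eta * (n%:R + K) <
    `|\sum_(i < n.+1) (truncate (level dl K i) (sigma i w) - truncated_mean dl K i)|].

Definition two_jumps (dl K : R) : set T :=
  [set w | exists i j : nat,
    [/\ (i < j)%N, level dl K i < sigma i w & level dl K j < sigma j w]].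

Let F1 x : F x <= 1. Proof. exact: tail_le1. Qed.
Let F_ni x y : x <= y -> F y <= F x. Proof. exact: tail_ni. Qed.

(** Since [alpha < 2], the variance of the claims truncated at [dl * (i + K)] is
    [O((dl * (i + K)) ^ (2 - alpha))]: in the maximal inequality this yields
    the order [K ^ (1 - alpha)] of the ruin probability, with a factor that
    vanishes as [dl] tends to 0. *)
Lemma claim_bad_small : exists2 C : R, 0 < C & forall dl eta K : R,
  0 < dl -> 0 < eta -> 2 <= K -> 1 <= dl * K ->
  pr P (claim_bad dl eta K) <= C * dl `^ (2 - alpha) / eta ^+ 2 * K `^ (1 - alpha).
Proof.
have [C0 C00 FC] := tail_upper A_gt0 alpha_gt1 sigma_tail F1.
have [C C_gt0 HC] := truncate_second_moment (sigma_ge0 0) C00 alpha_gt1 alpha_lt2 FC.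
pose D := (alpha - 1)^-1 * 2 `^ (alpha - 1).
have D0 : 0 < D.
  by rewrite mulr_gt0 ?invr_gt0 ?powR_gt0//; have := alpha_gt1; lra.
exists (C * D); first exact: mulr_gt0.
move=> dl eta K dl0 eta0 K2 dlK.
have iK i : 0 < i%:R + K by rewrite ltr_wpDl//; lra.
have dliK i : 1 <= level dl K i.
  by rewrite mulrDr; have := mulr_ge0 (ltW dl0) (ler0n R i); lra.
have mt i : measurable_fun setT (truncate (level dl K i)) by exact: measurable_truncate.
have lev0 i : 0 <= level dl K i by have := dliK i; lra.
have mtr i k : measurable_fun setT (fun w => truncate (level dl K i) (sigma k w)).
  exact: measurableT_comp.
have cst i := @centered_second_moment _ _ _ P (fun w => truncate (level dl K i) (sigma i w))
  (mtr i i) (integrable_truncate (sigma_ge0 i) (isigma i).1 _)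
  (integrable_truncate2 (sigma_ge0 i) (lev0 i)).
have mE i : \int[P]_w truncate (level dl K i) (sigma i w) = truncated_mean dl K i.
  have E k w : truncate (level dl K i) (sigma k w) = `|truncate (level dl K i) (sigma k w)|.
    by rewrite ger0_norm// truncate_ge0.
  rewrite /truncated_mean; under eq_Rintegral do rewrite E.
  under [RHS]eq_Rintegral do rewrite E.
  apply: (Rintegral_ident sigma_iid.2 (g := fun x => `|truncate (level dl K i) x|)) => //.
  by apply: measurableT_comp => //; exact: normr_measurable.
apply: (@hajek_renyi _ _ _ P sigma msigma sigma_iid.1
  (fun i x => truncate (level dl K i) x - truncated_mean dl K i) _
  (fun i => C * level dl K i `^ (2 - alpha)) (fun n => eta * (n%:R + K))).
- by move=> i; exact: measurable_funB.
- by move=> i; have [+ _ _] := cst i; rewrite mE.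
- by move=> i; have [_ + _] := cst i; rewrite mE.
- move=> i; have [_ _] := cst i; rewrite mE => /le_trans; apply.
  rewrite (Rintegral_ident sigma_iid.2 i 0 (g := fun x => truncate (level dl K i) x ^+ 2)).
  + exact: HC.
  + exact: measurable_funX.
  + by move=> x; exact: sqr_ge0.
- by move=> i; exact: mulr_gt0.
- by move=> i; rewrite ler_pM2l// lerD2r ler_nat.
- move=> N; apply: (@le_trans _ _ (\sum_(k < N)
    C * dl `^ (2 - alpha) / eta ^+ 2 * (k%:R + K) `^ (- alpha))).
    apply: ler_sum => k _; rewrite (powRM _ (ltW dl0) (ltW (iK k))).
    have -> : 2 - alpha = - alpha + 2%:R by ring.
    rewrite (@powRD _ (k%:R + K)) ?(gt_eqF (iK k)) ?implybT// powR_mulrn ?(ltW (iK k))//.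
    by rewrite le_eqVlt; apply/orP; left; apply/eqP; field; rewrite !gt_eqF.
  have -> : C * D * dl `^ (2 - alpha) / eta ^+ 2 * K `^ (1 - alpha) =
      C * dl `^ (2 - alpha) / eta ^+ 2 * (D * K `^ (1 - alpha)) by ring.
  rewrite -mulr_sumr ler_wpM2l//; last exact: powR_sum_le.
  by rewrite divr_ge0 ?sqr_ge0// mulr_ge0 ?powR_ge0// ltW.
Qed.

(** [O (K `^ (2 - 2 * alpha))] is negligible against [K `^ (1 - alpha)] for any
    fixed [dl]. *)
Lemma two_jumps_small (dl : R) : 0 < dl -> exists2 C : R, 0 < C &
  forall K : R, 2 <= K -> pr P (two_jumps dl K) <= (C * K `^ (1 - alpha)) ^+ 2.
Proof.
move=> dl0; have [C C0 HC] := profile_sum_le A_gt0 alpha_gt1 sigma_tail F1 F_ni dl0.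
exists C => // K K2.
apply: (@pr_two_events _ _ _ P (fun i => [set w | level dl K i < sigma i w])).
- by move=> n; exact: measurable_gt.
- move=> i j ij; rewrite !gt_preimage; apply: (independent_pair msigma sigma_iid.1) => //.
  by rewrite neq_ltn ij.
- move=> N; under eq_bigr do rewrite tail_ident.
  by apply: (HC K dl (fun x => dl * (x + K))) => // i.
Qed.

(** [dl] is fixed first, to control the truncated claims; then [K] is taken large
    enough for the other terms. *)
Lemma bad_small (eps eta : R) : 0 < eps -> 0 < eta ->
  exists dl K0 : R, [/\ 0 < dl, 2 <= K0 & forall K : R, K0 <= K ->
   [/\ pr P (arrival_bad eta K) <= eps * K `^ (1 - alpha),
       pr P (claim_bad dl eta K) <= eps * K `^ (1 - alpha),
       pr P (two_jumps dl K) <= eps * K `^ (1 - alpha) &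
       forall i, 1 / mu - eta <= truncated_mean dl K i <= 1 / mu]].
Proof.
move=> e0 eta0; have al1 := alpha_gt1; have al2 := alpha_lt2.
have [C1 C10 H1] := arrival_bad_small eta0.
have [C2 C20 H2] := claim_bad_small.
have [dl dl0 dlE] : exists2 dl : R, 0 < dl & C2 * dl `^ (2 - alpha) / eta ^+ 2 <= eps.
  have s0 : 2 - alpha != 0 by rewrite gt_eqF// subr_gt0.
  have r0 : 0 < eps * eta ^+ 2 / C2 by rewrite divr_gt0// mulr_gt0// exprn_gt0.
  have [t t0 tE] := powR_inv_root s0 r0; exists t => //.
  have := tE 1 ler01; rewrite mulr1 powR1 mulr1 => ->.
  by rewrite le_eqVlt; apply/orP; left; apply/eqP; field; rewrite !gt_eqF.
have [C3 C30 H3] := two_jumps_small dl0.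
have [Ka Ka2 HKa] := @powRN_small R (2 - alpha) (eps / C1) ltac:(lra) (divr_gt0 e0 C10).
have [Kb Kb2 HKb] := @powRN_small R (alpha - 1) (eps / C3 ^+ 2) ltac:(lra)
  (divr_gt0 e0 (exprn_gt0 2 C30)).
have [y0 y00 Hy] := truncate_mean_cvg (sigma_ge0 0) (isigma 0).1 eta0.
exists dl, (Num.max Ka (Num.max Kb (Num.max (dl^-1) (y0 / dl)))); split => //.
  by rewrite le_max Ka2.
move=> K; rewrite !ge_max => /and4P[KKa KKb Kdl Ky].
have K2 : 2 <= K by lra.
have K0 : 0 < K by lra.
have kp : 0 < K `^ (1 - alpha) by exact: powR_gt0.
split.
- apply: (le_trans (H1 K K2)); have := HKa K KKa.
  have -> : K^-1 = K `^ (- (2 - alpha)) * K `^ (1 - alpha).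
    rewrite -powRD ?(gt_eqF K0) ?implybT// -powR_inv1 ?(ltW K0)//.
    by congr (powR _ _); ring.
  by rewrite ler_pdivlMr// mulrA [C1 * _]mulrC ler_pM2r.
- apply: (le_trans (H2 dl eta K dl0 eta0 K2 _)); last by rewrite ler_pM2r.
  by rewrite -(ler_pdivrMl _ _ dl0) mulr1.
- apply: (le_trans (H3 K K2)); have := HKb K KKb.
  have -> : - (alpha - 1) = 1 - alpha by ring.
  rewrite ler_pdivlMr ?exprn_gt0// => h; have := ler_wpM2r (ltW kp) h.
  by rewrite exprMn; lra.
- move=> i; have [i0 i1] := isigma 0; rewrite -i1 truncate_mean_le// andbT.
  apply: Hy; move: Ky; rewrite ler_pdivrMr// mulrC => /le_trans; apply.
  by rewrite ler_pM2l// lerDr.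
Qed.


Let measurable_exceed (Y : nat -> T -> R) (b : nat -> R) :
  (forall n, measurable_fun setT (Y n)) ->
  measurable [set w | exists n, b n < `|Y n w|].
Proof.
move=> mY; have -> : [set w | exists n, b n < `|Y n w|] = \bigcup_n [set w | b n < `|Y n w|].
  by apply/seteqP; split=> w [n]; [exists n|move=> _; exists n].
apply: bigcupT_measurable => n; apply: measurable_gt.
by apply: measurableT_comp => //; exact: normr_measurable.
Qed.

Lemma measurable_arrival_bad eta K : measurable (arrival_bad eta K).
Proof.
apply: (@measurable_exceed (fun n w => \sum_(i < n.+1) (zeta i w - 1 / lambda))
  (fun n => eta * (n%:R + K))) => n.
by apply: measurable_sum => i; exact: measurable_funB.
Qed.

Lemma measurable_claim_bad dl eta K : measurable (claim_bad dl eta K).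
Proof.
apply: (@measurable_exceed (fun n w => \sum_(i < n.+1)
  (truncate (level dl K i) (sigma i w) - truncated_mean dl K i))
  (fun n => eta * (n%:R + K))) => n.
apply: measurable_sum => i; apply: measurable_funB => //.
by apply: measurableT_comp => //; exact: measurable_truncate.
Qed.

Lemma measurable_two_jumps dl K : measurable (two_jumps dl K).
Proof.
have -> : two_jumps dl K = \bigcup_i \bigcup_(j in [set j | (i < j)%N])
    ([set w | level dl K i < sigma i w] `&` [set w | level dl K j < sigma j w]).
  apply/seteqP; split=> w; first by move=> [i [j [ij wi wj]]]; exists i => //; exists j.
  by move=> [i _ [j ij [wi wj]]]; exists i, j.
apply: bigcupT_measurable => i; apply: bigcup_measurable => j _.
by apply: measurableI; exact: measurable_gt.
Qed.

Lemma arrival_goodP (eta K : R) w : 0 <= eta -> 0 <= K -> ~ arrival_bad eta K w ->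
  forall n : nat, `|arrival_time zeta n w - n%:R / lambda| <= eta * (n%:R + K).
Proof.
move=> eta0 K0 good [|n].
  by rewrite /arrival_time big_ord0 mul0r subrr normr0 mulr_ge0// add0r.
have -> : arrival_time zeta n.+1 w - n.+1%:R / lambda =
    \sum_(i < n.+1) (zeta i w - 1 / lambda).
  rewrite sumrB; congr (_ - _).
  by rewrite sumr_const card_ord -[RHS]mulr_natl mul1r.
apply: (@le_trans _ _ (eta * (n%:R + K))).
  by rewrite leNgt; apply/negP => h; apply: good; exists n.
by rewrite ler_wpM2l// lerD2r ler_nat.
Qed.

Lemma claim_goodP (dl eta K : R) w : 0 <= eta -> 0 <= K -> ~ claim_bad dl eta K w ->
  forall n : nat, `|truncated_claims dl K n w - \sum_(i < n) truncated_mean dl K i|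
    <= eta * (n%:R + K).
Proof.
move=> eta0 K0 good [|n].
  by rewrite /truncated_claims !big_ord0 subrr normr0 mulr_ge0// add0r.
rewrite /truncated_claims -sumrB.
apply: (@le_trans _ _ (eta * (n%:R + K))).
  by rewrite leNgt; apply/negP => h; apply: good; exists n.
by rewrite ler_wpM2l// lerD2r ler_nat.
Qed.

Lemma arrival_unbounded (eta K : R) w : 0 <= eta -> 0 <= K -> eta < 1 / lambda ->
  ~ arrival_bad eta K w -> forall x, exists n, x < arrival_time zeta n w.
Proof.
move=> eta0 K0 eta1 good x.
have g0 : 0 < 1 / lambda - eta by rewrite subr_gt0.
pose n := (Num.truncn (`|x + eta * K| / (1 / lambda - eta))).+1; exists n.
have : `|x + eta * K| / (1 / lambda - eta) < n%:R by exact: truncnS_gt.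
rewrite ltr_pdivrMr// => h; have := ler_norm (x + eta * K).
have := arrival_goodP eta0 K0 good n; rewrite ler_distl => /andP[+ _].
by have -> : n%:R / lambda = n%:R * (1 / lambda) by [rewrite mul1r]; lra.
Qed.

(** * One big jump: upper bound *)

(** The exceptional events cost a small multiple of [K `^ (1 - alpha)], hence of the
    integral. Elsewhere [E] forces a claim [sigma i] above [th * f i], and the
    union bound over [i] is a sum of tails close to the integral. *)
Lemma one_jump_upper (c0 c1 : R) (eps : R) : 0 < c0 -> 0 < c1 -> 0 < eps -> eps <= 1 ->
  exists th, [/\ 0 < th, th < 1 & forall eta : R, 0 < eta ->
  exists dl K0, [/\ 0 < dl, 2 <= K0 & forall (K : R) (f : R -> R) (E : set T),
    K0 <= K -> linear_profile c0 c1 K f -> measurable E ->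
    (forall w, E w -> ~ arrival_bad eta K w -> ~ claim_bad dl eta K w ->
       ~ two_jumps dl K w -> (forall i, truncated_mean dl K i <= 1 / mu) ->
       exists i : nat, th * f i%:R < sigma i w) ->
    pr P E <= (1 + eps) * profile_integral F f]].
Proof.
move=> c00 c10 e0 e1.
have [c [C [Ke [c_gt0 C_gt0 Ke2 est]]]] := profile_estimates A_gt0 alpha_gt1 sigma_tail
  (tail_ge0 _) F1 F_ni (measurable_tail _) c00 c10.
have [th [x0 [th0 th1 x00 Hth]]] := tail_scale_up A_gt0 alpha_gt1 sigma_tail
  (divr_gt0 e0 (ltr0n R 2)) ltac:(lra).
exists th; split => // eta eta0.
(* the error terms add up to [9 / 2 * e1' * k], less than [eps / 2 * I] *)
pose e1' := c * eps / 10.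
have e10 : 0 < e1' by rewrite divr_gt0// mulr_gt0.
have [dl [Kb [dl0 Kb2 bad]]] := bad_small e10 eta0.
exists dl, (Num.max Ke (Num.max Kb (Num.max (x0 / c0) (C / e1')))); split => //.
  by rewrite le_max Ke2.
move=> K f E; rewrite !ge_max => /and4P[KKe KKb Kx KC] fp mE cover.
have K0 : 0 < K by lra.
have [_ If Ff0 sumF _] := est K f KKe fp; have [mf f_nd fb] := fp.
have [b1 b2 b3 b4] := bad K KKb.
set k := K `^ (1 - alpha) in If b1 b2 b3.
set I := profile_integral F f in If sumF *.
have kp : 0 < k by exact: powR_gt0.
have Ff : F (f 0) <= e1' * k.
  apply: (le_trans Ff0); have -> : K `^ (- alpha) = K^-1 * k.
    rewrite /k -powR_inv1 ?(ltW K0)// -powRD ?(gt_eqF K0) ?implybT//.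
    by congr (powR _ _); ring.
  rewrite mulrA ler_pM2r// ler_pdivrMr// mulrC.
  by rewrite -ler_pdivrMr.
pose J i := [set w | th * f i%:R < sigma i w].
have mJ i : measurable (J i) by exact: measurable_gt.
have f_ge i : x0 <= f i%:R.
  have /andP[+ _] := fb i%:R (ler0n _ i); apply: le_trans.
  by move: Kx; rewrite ler_pdivrMr//; have := ler0n R i; nra.
have prJ : pr P (\bigcup_i J i) <= (1 + eps / 2) * (F (f 0) + I).
  apply: pr_bigcup_le => // N.
  apply: (@le_trans _ _ ((1 + eps / 2) * \sum_(i < N) F (f i%:R))); last first.
    by rewrite ler_wpM2l//; lra.
  rewrite mulr_sumr; apply: ler_sum => i _.
  by rewrite /J tail_ident; exact: Hth.
have mab := measurable_arrival_bad eta K.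
have mcb := measurable_claim_bad dl eta K.
have mtj := measurable_two_jumps dl K.
have mUJ : measurable (\bigcup_i J i) by exact: bigcupT_measurable.
have EU : E `<=` arrival_bad eta K `|` (claim_bad dl eta K `|` (two_jumps dl K `|` \bigcup_i J i)).
  move=> w Ew.
  have [ab|gab] := pselect (arrival_bad eta K w); first by left.
  have [cb|gcb] := pselect (claim_bad dl eta K w); first by right; left.
  have [tj|gtj] := pselect (two_jumps dl K w); first by right; right; left.
  right; right; right.
  have [|i wi] := cover w Ew gab gcb gtj; last by exists i.
  by move=> i; have /andP[] := b4 i.
have m3 := measurableU _ _ mtj mUJ.
have m2 := measurableU _ _ mcb m3.
have := pr_le P mE (measurableU _ _ mab m2) EU.
have := pr_setU_le P mab m2; have := pr_setU_le P mcb m3.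
have := pr_setU_le P mtj mUJ.
have ek : e1' * k <= eps / 10 * I.
  by rewrite /e1' mulrAC [c * eps]mulrC -mulrA; have := ler_wpM2l (ltW e0) If; lra.
move: prJ Ff b1 b2 b3 If; set a1 := F (f 0).
have Fp : 0 <= a1 by exact: tail_ge0.
move=> prJ Ff b1 b2 b3 If u1 u2 u3 u4.
have : (1 + eps / 2) * (a1 + I) <= 3 / 2 * a1 + (1 + eps / 2) * I by nra.
nra.
Qed.


(** * One big jump: lower bound *)

Lemma arrival_bad_indep (eta K : R) (x : R) i :
  pr P ([set w | x < sigma i w] `&` arrival_bad eta K) =
  pr P [set w | x < sigma i w] * pr P (arrival_bad eta K).
Proof.
have mJ : measurable [set w | x < sigma i w] by exact: measurable_gt.
have mB := measurable_arrival_bad eta K.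
have gB : generated_salgebra zeta (arrival_bad eta K).
  rewrite generated_salgebraE.
  have -> : arrival_bad eta K = \bigcup_n
     ([set: g_sigma_algebraType (cylinders zeta setT)] `&`
      (fun w => \sum_(i < n.+1) (zeta i w - 1 / lambda)) @^-1`
      [set y | eta * (n%:R + K) < `|y|]).
    by apply/seteqP; split=> w; [move=> [n hn]; exists n|move=> [n _ [_ hn]]; exists n].
  apply: (@bigcupT_measurable _ (g_sigma_algebraType (cylinders zeta setT))) => n.
  apply: (@measurable_sum_cylinders _ _ _ zeta setT n.+1 (fun i x => x - 1 / lambda)) => //.
    by move=> j; exact: measurable_funB.
  exact: (measurable_gt (eta * (n%:R + K)) (@normr_measurable R setT)).
have gJ : generated_salgebra sigma [set w | x < sigma i w].
  apply: sub_sigma_algebra; exists i, `]x, +oo[%classic; split => //.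
  exact: gt_preimage.
have := zeta_sigma_indep gB gJ.
rewrite (prE P mB) (prE P mJ) (prE P (measurableI _ _ mB mJ)) -EFinM => H.
by rewrite setIC mulrC (EFin_inj H).
Qed.

Lemma truncated_claims_indep (dl K x y : R) i :
  pr P ([set w | x < sigma i w] `&` [set w | truncated_claims dl K i w < y]) =
  pr P [set w | x < sigma i w] * pr P [set w | truncated_claims dl K i w < y].
Proof.
rewrite gt_preimage setIC mulrC; apply: (indep_past msigma sigma_iid.1) => //.
have -> : [set w | truncated_claims dl K i w < y] =
    [set: g_sigma_algebraType (cylinders (fun x => sigma x) `I_i)] `&`
    truncated_claims dl K i @^-1` `]-oo, y[%classic.
  by rewrite setTI; apply/seteqP; split=> w /=; rewrite in_itv.
apply: (@measurable_sum_cylinders _ _ _ sigma `I_i i (fun i x => truncate (level dl K i) x)) => //.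
by move=> j; exact: measurable_truncate.
Qed.

(** A claim [sigma i] above [th * f i] suffices for [E] unless the arrival times or
    the claims before [i] are atypical. These are independent of [sigma i], so they
    remove a small fraction of each term of the union bound, which is itself sharp
    since the events are rare. *)
Lemma one_jump_lower (c0 c1 : R) (eps : R) : 0 < c0 -> 0 < c1 -> 0 < eps -> eps <= 1 ->
  exists2 th, 1 < th & forall eta : R, 0 < eta ->
  exists dl K0, [/\ 0 < dl, 2 <= K0 & forall (K : R) (f : R -> R) (E : set T),
    K0 <= K -> linear_profile c0 c1 K f -> measurable E ->
    (forall w (i : nat), ~ arrival_bad eta K w ->
       i%:R / mu - 2 * eta * (i%:R + K) <= truncated_claims dl K i w ->
       th * f i%:R < sigma i w -> E w) ->
    (1 - eps) * profile_integral F f <= pr P E].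
Proof.
move=> c00 c10 e0 e1; have al1 := alpha_gt1.
have [c [C [Ke [c_gt0 C_gt0 Ke2 est]]]] := profile_estimates A_gt0 alpha_gt1 sigma_tail
  (tail_ge0 _) F1 F_ni (measurable_tail _) c00 c10.
have [th [x0 [th1 x00 Hth]]] := tail_scale_down A_gt0 alpha_gt1 sigma_tail
  (divr_gt0 e0 (ltr0n R 4)) ltac:(lra).
have [C' C'0 sumC] := profile_sum_le A_gt0 alpha_gt1 sigma_tail F1 F_ni c00.
exists th => // eta eta0.
have [dl [Kb [dl0 Kb2 bad]]] := bad_small ltr01 eta0.
have e40 : 0 < eps / 4 / (C' + 2) by rewrite !divr_gt0// addr_gt0.
have [Kd Kd2 HKd] := @powRN_small R (alpha - 1) (eps / 4 / (C' + 2)) ltac:(lra) e40.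
exists dl, (Num.max Ke (Num.max Kb (Num.max (x0 / c0) Kd))); split => //.
  by rewrite le_max Ke2.
move=> K f E; rewrite !ge_max => /and4P[KKe KKb Kx KKd] fp mE cover.
have K0 : 0 < K by lra.
have K2 : 2 <= K by lra.
have [_ If _ _ sup] := est K f KKe fp; have [mf f_nd fb] := fp.
have [b1 b2 _ b4] := bad K KKb.
have k_small := HKd K KKd; rewrite opprB in k_small.
set k := K `^ (1 - alpha) in If b1 b2 k_small sumC.
set I := profile_integral F f in If sup *.
have kp : 0 < k by exact: powR_gt0.
have Ip : 0 < I by apply: lt_le_trans If; exact: mulr_gt0.
have f_ge i : x0 <= f i%:R.
  have /andP[+ _] := fb i%:R (ler0n _ i); apply: le_trans.
  by move: Kx; rewrite ler_pdivrMr//; have := ler0n R i; nra.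
have [N HN] : exists N, (1 - eps / 4) * I < \sum_(i < N) F (f i%:R).
  by apply: sup; rewrite gtr_pMl//; lra.
pose J i := [set w | th * f i%:R < sigma i w].
pose B i := [set w | truncated_claims dl K i w < i%:R / mu - 2 * eta * (i%:R + K)].
have mJ i : measurable (J i) by exact: measurable_gt.
have mtc i : measurable_fun setT (truncated_claims dl K i).
  apply: measurable_sum => j; apply: measurableT_comp => //.
  exact: measurable_truncate.
have mB i : measurable (B i) by exact: measurable_ltr_set.
have mab := measurable_arrival_bad eta K.
have mcb := measurable_claim_bad dl eta K.
pose s := \sum_(i < N) pr P (J i).
have s_ge : (1 - eps / 4) * \sum_(i < N) F (f i%:R) <= s.
  rewrite mulr_sumr; apply: ler_sum => i _.
  by rewrite /J tail_ident; exact: Hth.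
have s_le : s <= C' * k.
  rewrite /s; under eq_bigr do rewrite /J tail_ident.
  apply: (sumC K (th * c0) (fun x => th * f x)) => //.
    by rewrite ler_pMl// ltW.
  move=> i; rewrite -mulrA ler_pM2l; last by lra.
  by have /andP[] := fb i%:R (ler0n _ i).
have s0 : 0 <= s by apply: sumr_ge0 => i _; exact: pr_ge0.
have B_le i : pr P (B i) <= k.
  rewrite -[leRHS]mul1r; apply: le_trans b2; apply: pr_le => // w /= Bw.
  apply: contrapT => good; have := claim_goodP (ltW eta0) (ltW K0) good i.
  rewrite ler_distl => /andP[+ _].
  have : i%:R / mu - eta * i%:R <= \sum_(j < i) truncated_mean dl K j.
    have -> : i%:R / mu - eta * i%:R = \sum_(j < i) (1 / mu - eta).
      rewrite sumr_const card_ord -[RHS]mulr_natl; ring.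
    by apply: ler_sum => j _; have /andP[] := b4 j.
  have := mulr_gt0 eta0 K0; move: Bw; rewrite /B/=; lra.
have JU : \big[setU/set0]_(i < N) J i `<=`
   E `|` \big[setU/set0]_(i < N) ((J i `&` arrival_bad eta K) `|` (J i `&` B i)).
  rewrite -(bigcup_mkord N J) -(bigcup_mkord N
    (fun i => (J i `&` arrival_bad eta K) `|` (J i `&` B i))) => w [i /= iN Jw].
  have [ab|gab] := pselect (arrival_bad eta K w).
    by right; exists i => //; left.
  have [Bw|gB] := pselect (B i w); first by right; exists i => //; right.
  by left; apply: (cover w i) => //; rewrite leNgt; apply/negP.
have mJab i : measurable (J i `&` arrival_bad eta K) by exact: measurableI.
have mJB i : measurable (J i `&` B i) by exact: measurableI.
have mV i : measurable ((J i `&` arrival_bad eta K) `|` (J i `&` B i)) by exact: measurableU.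
have V_le : pr P (\big[setU/set0]_(i < N) ((J i `&` arrival_bad eta K) `|` (J i `&` B i)))
    <= s * (2 * k).
  apply: (le_trans (@pr_bigsetU_le _ _ _ P
    (fun i => (J i `&` arrival_bad eta K) `|` (J i `&` B i)) N mV)).
  rewrite /s mulr_suml; apply: ler_sum => i _.
  apply: (le_trans (pr_setU_le P (mJab i) (mJB i))).
  rewrite /J arrival_bad_indep truncated_claims_indep -mulrDr ler_wpM2l ?pr_ge0//.
  by have := B_le i; move: b1; rewrite mul1r /B; lra.
have mUJ : measurable (\big[setU/set0]_(i < N) J i) by exact: bigsetU_measurable.
have mUV := @bigsetU_measurable _ T _ (index_enum 'I_N) xpredT
  (fun i => (J i `&` arrival_bad eta K) `|` (J i `&` B i)) (fun i _ => mV i).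
have := @pr_bigcup_ge _ _ _ P J N mJ.
rewrite -/s => bonf; have {}bonf : s - s ^+ 2 <= pr P (\big[setU/set0]_(i < N) J i).
  apply: bonf => i j ij.
  rewrite /J !gt_preimage; apply: (independent_pair msigma sigma_iid.1) => //.
  by rewrite neq_ltn ij.
have u1 := pr_le P mUJ (measurableU _ _ mE mUV) JU.
have u2 := pr_setU_le P mE mUV.
have sE : s * (1 - s - 2 * k) <= pr P E.
  by move: bonf V_le u1 u2; rewrite expr2; lra.
apply: le_trans sE.
have k2 : s + 2 * k <= eps / 4.
  apply: (@le_trans _ _ ((C' + 2) * k)); first by lra.
  by move: k_small; rewrite ler_pdivlMr ?addr_gt0// mulrC.
have q0 : 0 < 1 - eps / 4 by lra.
have s1 : (1 - eps / 4) * ((1 - eps / 4) * I) <= s.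
  by apply: le_trans s_ge; rewrite ler_pM2l// ltW.
apply: (@le_trans _ _ (s * (1 - eps / 4))); last by rewrite ler_wpM2l//; lra.
have := ler_wpM2r (ltW q0) s1; apply: le_trans.
have e2 : eps * eps <= eps by rewrite ger_pMl.
have q3 : 1 - eps <= (1 - eps / 4) * (1 - eps / 4) * (1 - eps / 4) by nra.
by have := ler_wpM2r (ltW Ip) q3; lra.
Qed.


(** * Ruin probabilities of the two-dimensional problem *)

Variables (p1 p2 a : R).
Hypothesis p12 : p2 < p1.
Hypothesis p2_gt : lambda / mu < p2.
Hypothesis a_gt0 : 0 < a.
Hypothesis a_lt1 : a < 1.
Let m1 := p1 * (1 / lambda) - 1 / mu.
Let m2 := p2 * (1 / lambda) - 1 / mu.

Let p2_gt0 : 0 < p2.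
Proof. by apply: lt_trans p2_gt; exact: divr_gt0. Qed.
Let p1_gt0 : 0 < p1.
Proof. exact: lt_trans p12. Qed.
Let m2_gt0 : 0 < m2.
Proof.
rewrite /m2 subr_gt0 !mul1r ltr_pdivlMr// mulrC; exact: p2_gt.
Qed.
Let m1_gt0 : 0 < m1.
Proof.
by apply: (lt_trans m2_gt0); rewrite ltrD2r ltr_pM2r// mul1r invr_gt0.
Qed.

Definition min_profile (K t : R) := Num.min (a * K + m1 * t) (K + m2 * t).
Definition max_profile (K t : R) := Num.max (a * K + m1 * t) (K + m2 * t).

Let c0 := Num.min a (Num.min m1 m2).
Let c1 := 1 + m1 + m2.
Let c0_gt0 : 0 < c0.
Proof. by rewrite !lt_min a_gt0 m1_gt0. Qed.
Let c1_gt0 : 0 < c1.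
Proof. by rewrite /c1; have := m1_gt0; have := m2_gt0; lra. Qed.

Let line1 (K t : R) : 0 < K -> 0 <= t ->
  c0 * (t + K) <= a * K + m1 * t <= c1 * (t + K).
Proof.
move=> K0 t0; have c0a : c0 <= a by rewrite ge_min lexx.
have c0m : c0 <= m1 by rewrite !ge_min lexx !orbT.
have := m1_gt0; have := m2_gt0; have := a_lt1; have := a_gt0.
rewrite /c1 => aa a1 mm2 mm1; apply/andP; split; first by nra.
have := mulr_ge0 (ltW mm2) t0; have := mulr_ge0 (ltW mm1) (ltW K0).
by have := mulr_ge0 (ltW mm2) (ltW K0); nra.
Qed.

Let line2 (K t : R) : 0 < K -> 0 <= t ->
  c0 * (t + K) <= K + m2 * t <= c1 * (t + K).
Proof.
move=> K0 t0; have c0a : c0 <= a by rewrite ge_min lexx.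
have c0m : c0 <= m2 by rewrite !ge_min lexx !orbT.
have := m1_gt0; have := m2_gt0; have := a_lt1; have := a_gt0.
rewrite /c1 => aa a1 mm2 mm1; apply/andP; split; first by nra.
have := mulr_ge0 (ltW mm1) t0; have := mulr_ge0 (ltW mm1) (ltW K0).
by have := mulr_ge0 (ltW mm2) (ltW K0); nra.
Qed.

Let mline (x m : R) : measurable_fun setT (fun t : R => x + m * t).
Proof. by apply: measurable_funD => //; exact: measurable_funM. Qed.

Let line_nd (x m s t : R) : 0 < m -> s <= t -> x + m * s <= x + m * t.
Proof. by move=> m0 st; rewrite lerD2l ler_pM2l. Qed.

Let min_profileP K : 0 < K -> linear_profile c0 c1 K (min_profile K).
Proof.
move=> K0; split; first exact: measurable_minr.
- by move=> x y _ xy; rewrite /min_profile le_min !ge_min !line_nd// ?orbT.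
- move=> t t0; have /andP[l1 u1] := line1 K0 t0; have /andP[l2 u2] := line2 K0 t0.
  by rewrite /min_profile le_min ge_min l1 l2 u1.
Qed.

Let max_profileP K : 0 < K -> linear_profile c0 c1 K (max_profile K).
Proof.
move=> K0; split; first exact: measurable_maxr.
- by move=> x y _ xy; rewrite /max_profile ge_max !le_max !line_nd// ?orbT.
- move=> t t0; have /andP[l1 u1] := line1 K0 t0; have /andP[l2 u2] := line2 K0 t0.
  by rewrite /max_profile ge_max le_max l1 u1 u2.
Qed.

Local Notation cross g := (crossing zeta sigma g).
Local Notation b1 K := (fun t => a * K + p1 * t).
Local Notation b2 K := (fun t => K + p2 * t).

Let mcross_min K : measurable (cross (fun t => Num.min (b1 K t) (b2 K t))).
Proof. by apply: measurable_crossing => //; apply: measurable_minr. Qed.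
Let mcross_max K : measurable (cross (fun t => Num.max (b1 K t) (b2 K t))).
Proof. by apply: measurable_crossing => //; apply: measurable_maxr. Qed.
Let mcross_times K : measurable (cross (b1 K) `&` cross (b2 K)).
Proof. by apply: measurableI; apply: measurable_crossing. Qed.

(** A crossing of line [k] needs a claim [sigma i] above line [k] at [i]. Ruin for the
    minimum needs one such claim for one of the lines; crossings of both lines,
    even at different times, need it for both, and two large claims are
    excluded. *)
Lemma ruin_upper (eps : R) : 0 < eps -> eps <= 1 -> exists K0 : R, forall K, K0 <= K ->
  pr P (cross (fun t => Num.min (b1 K t) (b2 K t))) <=
    (1 + eps) * profile_integral F (min_profile K) /\
  pr P (cross (b1 K) `&` cross (b2 K)) <=
    (1 + eps) * profile_integral F (max_profile K).
Proof.
move=> e0 e1; have [th [th0 th1 H]] := one_jump_upper c0_gt0 c1_gt0 e0 e1.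
(* each drifted line is at least [c0 * (t + K)], so that this relative error
   moves it by a factor at most [th] *)
pose eta := (1 - th) * c0 / (p1 + 1).
have pp : 0 < p1 + 1 by have := p1_gt0; lra.
have eta0 : 0 < eta by rewrite divr_gt0// mulr_gt0// subr_gt0.
have etaE : (p1 + 1) * eta = (1 - th) * c0 by rewrite mulrC divfK// gt_eqF.
clearbody eta.
have [dl [K0 [dl0 K02 {}H]]] := H eta eta0.
exists K0 => K KK0; have K_gt0 : 0 < K by lra.
have key p x m : 0 < p -> p <= p1 -> m = p * (1 / lambda) - 1 / mu -> 0 < m -> 0 < x ->
    (forall t, 0 <= t -> c0 * (t + K) <= x + m * t) ->
    forall w, cross (fun t => x + p * t) w ->
    ~ arrival_bad eta K w -> ~ claim_bad dl eta K w -> ~ two_jumps dl K w ->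
    (forall i, truncated_mean dl K i <= 1 / mu) ->
    exists i : nat, level dl K i < sigma i w /\ th * (x + m * i%:R) < sigma i w.
  move=> p0 pp1 mE m0 x0 line w [n [_ cr]] gab gcb gtj means; rewrite mE.
  apply: (@large_jump_of_crossing _ _ zeta sigma lambda mu dl eta K w th p x n) => //.
  - by rewrite -mE ltW.
  - exact: ltW.
  - move=> k; have := arrival_goodP (ltW eta0) (ltW K_gt0) gab k.
    by rewrite ler_distl => /andP[+ _].
  - move=> k; have := claim_goodP (ltW eta0) (ltW K_gt0) gcb k.
    rewrite ler_distl => /andP[_ +]; rewrite /truncated_claims => /le_trans; apply.
    rewrite lerD2r; apply: (@le_trans _ _ (\sum_(j < k) (1 / mu))).
      by apply: ler_sum => j _; exact: means.
    by rewrite sumr_const card_ord -[leLHS]mulr_natl mul1r.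
  - move=> i j li lj; apply/eqP; rewrite eqn_leq; apply/andP; split.
      by rewrite leqNgt; apply/negP => ji; apply: gtj; exists j, i.
    by rewrite leqNgt; apply/negP => ij; apply: gtj; exists i, j.
  - move=> k; rewrite -mE; apply: (@le_trans _ _ ((1 - th) * (c0 * (k%:R + K)))).
      rewrite mulrA -etaE; have kK : 0 < k%:R + K by rewrite ltr_wpDl.
      apply: ler_wpM2r; first exact: ltW.
      by apply: ler_wpM2r; [exact: ltW|rewrite lerD2r].
    by rewrite ler_pM2l ?subr_gt0//; exact: line.
have key1 := key p1 (a * K) m1 p1_gt0 (lexx _) erefl m1_gt0 (mulr_gt0 a_gt0 K_gt0)
  (fun t t0 => proj1 (andP (line1 K_gt0 t0))).
have key2 := key p2 K m2 p2_gt0 (ltW p12) erefl m2_gt0 K_gt0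
  (fun t t0 => proj1 (andP (line2 K_gt0 t0))).
split.
  apply: (H K _ _ KK0 (min_profileP K_gt0) (mcross_min K)).
  move=> w [n [nn]]; rewrite gt_min => /orP[h|h] gab gcb gtj means.
    have [|i [_ hi]] := key1 w _ gab gcb gtj means; first by exists n.
    exists i; apply: le_lt_trans hi; rewrite ler_pM2l//.
    by rewrite /min_profile ge_min lexx.
  have [|i [_ hi]] := key2 w _ gab gcb gtj means; first by exists n.
  exists i; apply: le_lt_trans hi; rewrite ler_pM2l//.
  by rewrite /min_profile ge_min lexx orbT.
apply: (H K _ _ KK0 (max_profileP K_gt0) (mcross_times K)).
move=> w [cr1 cr2] gab gcb gtj means.
have [i [li hi]] := key1 w cr1 gab gcb gtj means.
have [j [lj hj]] := key2 w cr2 gab gcb gtj means.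
(* two distinct large claims are excluded, so one claim crosses both lines *)
have ij : i = j.
  apply/eqP; rewrite eqn_leq; apply/andP; split.
    by rewrite leqNgt; apply/negP => ji; apply: gtj; exists j, i.
  by rewrite leqNgt; apply/negP => ij; apply: gtj; exists i, j.
rewrite -ij in hj; exists i; rewrite /max_profile.
by case: (leP (a * K + m1 * i%:R) (K + m2 * i%:R)).
Qed.

Lemma ruin_lower (eps : R) : 0 < eps -> eps <= 1 -> exists K0 : R, forall K, K0 <= K ->
  (1 - eps) * profile_integral F (min_profile K) <=
    pr P (cross (fun t => Num.min (b1 K t) (b2 K t))) /\
  (1 - eps) * profile_integral F (max_profile K) <=
    pr P (cross (fun t => Num.max (b1 K t) (b2 K t))).
Proof.
move=> e0 e1; have [th th1 H] := one_jump_lower c0_gt0 c1_gt0 e0 e1.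
have th10 : 0 < th - 1 by rewrite subr_gt0.
have pp : 0 < 4 * (p1 + 1) by have := p1_gt0; lra.
(* half of the room [(th - 1) * c0 * (i + K)] is kept for the constant
   [p1 / lambda]: the claim [sigma i] arrives at epoch [i.+1] *)
pose eta := Num.min ((th - 1) * c0 / (4 * (p1 + 1))) (1 / lambda / 2).
have eta0 : 0 < eta by rewrite lt_min !divr_gt0// mulr_gt0.
have etaE : 4 * (p1 + 1) * eta <= (th - 1) * c0.
  by rewrite mulrC -ler_pdivlMr// ge_min lexx.
have etal : eta < 1 / lambda.
  apply: (@le_lt_trans _ _ (1 / lambda / 2)); first by rewrite ge_min lexx orbT.
  by have : 0 < 1 / lambda by [rewrite divr_gt0]; lra.
clearbody eta.
have [dl [K0 [dl0 K02 {}H]]] := H eta eta0.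
have tc : 0 < (th - 1) * c0 by rewrite mulr_gt0.
exists (Num.max K0 (2 * (p1 / lambda) / ((th - 1) * c0))) => K.
rewrite ge_max => /andP[KK0 KK1]; have K2 : 2 <= K by lra.
have K_gt0 : 0 < K by lra.
have key p x m : 0 < p -> p <= p1 -> m = p * (1 / lambda) - 1 / mu -> 0 < m -> 0 < x ->
    (forall t, 0 <= t -> c0 * (t + K) <= x + m * t) ->
    forall w i, ~ arrival_bad eta K w ->
    i%:R / mu - 2 * eta * (i%:R + K) <= truncated_claims dl K i w ->
    th * (x + m * i%:R) < sigma i w ->
    x + p * arrival_time zeta i.+1 w < claim_sum sigma i.+1 w.
  move=> p0 pp1 mE m0 x0 line w i gab gtc; rewrite mE => jump.
  apply: (@crossing_of_large_jump _ _ zeta sigma lambda mu dl eta K w th p x i) => //.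
  - have := arrival_goodP (ltW eta0) (ltW K_gt0) gab i.+1.
    by rewrite ler_distl => /andP[_].
  - by apply: ler_sum => j _; exact: truncate_le.
  - rewrite -mE; have := line i%:R (ler0n _ i); rewrite -(ler_pM2l th10); apply: le_trans.
    have i0 : 0 <= i%:R :> R by [].
    have pl : p / lambda <= p1 / lambda by rewrite ler_pM2r// invr_gt0.
    have lK : p1 / lambda <= (th - 1) * c0 / 2 * K.
      by move: KK1; rewrite ler_pdivrMr//; lra.
    have iK : 0 < i%:R + K by lra.
    have pe : p * eta * (i%:R + 1 + K) <= p1 * eta * (2 * (i%:R + K)).
      apply: ler_pM; rewrite ?mulr_ge0 ?(ltW p0) ?(ltW eta0)//; first lra.
        by rewrite ler_pM2r.
      by lra.
    have et : (2 * p1 + 2) * eta * (i%:R + K) <= (th - 1) * c0 / 2 * (i%:R + K).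
      by rewrite ler_pM2r//; lra.
    have ti := mulr_ge0 (ltW tc) i0.
    by move: lK pe et; rewrite !mulrDr; lra.
have key1 := key p1 (a * K) m1 p1_gt0 (lexx _) erefl m1_gt0 (mulr_gt0 a_gt0 K_gt0)
  (fun t t0 => proj1 (andP (line1 K_gt0 t0))).
have key2 := key p2 K m2 p2_gt0 (ltW p12) erefl m2_gt0 K_gt0
  (fun t t0 => proj1 (andP (line2 K_gt0 t0))).
have th0 : 0 < th by lra.
split.
  apply: (H K _ _ KK0 (min_profileP K_gt0) (mcross_min K)).
  move=> w i gab gtc jump; apply: (@crossing_of_lt _ _ zeta sigma zeta_ge0 sigma_ge0 _ i.+1).
    exact: (arrival_unbounded (ltW eta0) (ltW K_gt0) etal gab).
  rewrite gt_min; move: jump; rewrite /min_profile.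
  case: (leP (a * K + m1 * i%:R) (K + m2 * i%:R)) => _ jump.
    by rewrite key1.
  by rewrite key2// orbT.
apply: (H K _ _ KK0 (max_profileP K_gt0) (mcross_max K)).
move=> w i gab gtc jump; apply: (@crossing_of_lt _ _ zeta sigma zeta_ge0 sigma_ge0 _ i.+1).
  exact: (arrival_unbounded (ltW eta0) (ltW K_gt0) etal gab).
rewrite gt_max; apply/andP; split; [apply: key1|apply: key2] => //;
  by apply: le_lt_trans jump; rewrite ler_pM2l// /max_profile le_max lexx ?orbT.
Qed.

Lemma ruin_max_le_times (K : R) :
  pr P (cross (fun t => Num.max (b1 K t) (b2 K t))) <=
  pr P (cross (b1 K) `&` cross (b2 K)).
Proof.
apply: pr_le => // w [n [nn]]; rewrite gt_max => /andP[h1 h2].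
by split; exists n.
Qed.

Lemma profile_integral_gt0 : exists K0 : R, forall K, K0 <= K ->
  0 < profile_integral F (min_profile K) /\ 0 < profile_integral F (max_profile K).
Proof.
have [c [C [Ke [c_gt0 C_gt0 Ke2 est]]]] := profile_estimates A_gt0 alpha_gt1 sigma_tail
  (tail_ge0 _) F1 F_ni (measurable_tail _) c0_gt0 c1_gt0.
exists Ke => K KKe; have K0 : 0 < K by lra.
have k0 : 0 < c * K `^ (1 - alpha) by rewrite mulr_gt0// powR_gt0.
have [_ I1 _ _ _] := est K _ KKe (min_profileP K0).
have [_ I2 _ _ _] := est K _ KKe (max_profileP K0).
by split; [exact: lt_le_trans I1|exact: lt_le_trans I2].
Qed.

(** At each time [F] of the minimum plus [F] of the maximum is the sum of [F] over
    the two lines. *)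
Lemma min_max_integrals (K : R) : 0 < K ->
  1 / (m1 * mu) * (1 - integrated_tail mu F (a * K)) +
  1 / (m2 * mu) * (1 - integrated_tail mu F K) -
  profile_integral F (max_profile K) = profile_integral F (min_profile K).
Proof.
move=> K0; have [i0 E0] := isigma 0.
have aK := mulr_gt0 a_gt0 K0.
rewrite -(tail_line_integralE (sigma_ge0 0) i0 mu_gt0 E0 m1_gt0 aK).
rewrite -(tail_line_integralE (sigma_ge0 0) i0 mu_gt0 E0 m2_gt0 K0).
have [j1 _] := tail_line_integral (sigma_ge0 0) i0 m1_gt0 aK.
have [j2 _] := tail_line_integral (sigma_ge0 0) i0 m2_gt0 K0.
have mF := measurable_tail (sigma 0%N).
have sub (f : R -> R) : measurable_fun setT f ->
    (forall t, F (f t) <= F (a * K + m1 * t) + F (K + m2 * t)) ->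
    (@lebesgue_measure R).-integrable `[0, +oo[ (fun t => (F (f t))%:E).
  move=> mf fle.
  have jj : (@lebesgue_measure R).-integrable `[0, +oo[
      (fun t => (F (a * K + m1 * t) + F (K + m2 * t))%:E).
    have mI : measurable (`[0, +oo[%classic : set (measurableTypeR R)) by exact: measurable_itv.
    by have := integrableD mI j1 j2; apply: eq_integrable.
  apply: le_integrable jj => //.
    by apply/measurable_EFinP; apply: measurable_funTS; exact: measurableT_comp.
  move=> t _ /=; rewrite lee_fin ger0_norm ?tail_ge0//.
  by rewrite ger0_norm; [exact: fle|rewrite addr_ge0 ?tail_ge0].
have [mmin _ _] := min_profileP K0; have [mmax _ _] := max_profileP K0.
have imin := sub _ mmin; have imax := sub _ mmax.
apply/eqP; rewrite subr_eq; apply/eqP.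
have mI : measurable (`[0, +oo[%classic : set (measurableTypeR R)) by exact: measurable_itv.
rewrite /profile_integral -(RintegralD mI j1 j2) -(RintegralD mI); last 2 first.
- apply: imin => t; rewrite /min_profile minEle.
  by case: ifP => _; rewrite ?lerDl ?lerDr tail_ge0.
- apply: imax => t; rewrite /max_profile maxEle.
  by case: ifP => _; rewrite ?lerDl ?lerDr tail_ge0.
apply: eq_Rintegral => t _; rewrite /min_profile /max_profile minEle maxEle.
by case: ifP => _ //; rewrite addrC.
Qed.

End model.

(** * Asymptotic equivalence *)

Section asymptotic_equivalence.
Context (R : realType).
Implicit Types f g h : R -> R.

Lemma asymp_equiv_squeeze f g :
  (exists K0 : R, forall K, K0 <= K -> 0 < g K) ->
  (forall eps : R, 0 < eps -> eps <= 1 -> exists K0 : R, forall K, K0 <= K ->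
    (1 - eps) * g K <= f K <= (1 + eps) * g K) -> asymp_equiv f g.
Proof.
move=> [K1 g0] H; apply/cvgrPdist_le => eps e0.
have m0 : 0 < Num.min eps 1 by rewrite lt_min e0 ltr01.
have m1 : Num.min eps 1 <= 1 by rewrite ge_min lexx orbT.
have [K2 HK] := H _ m0 m1.
exists (Num.max K1 K2); split; first exact: num_real.
move=> K; rewrite gt_max => /andP[/ltW KK1 /ltW KK2] /=.
have gp := g0 K KK1; have /andP[lo up] := HK K KK2.
have me : Num.min eps 1 <= eps by rewrite ge_min lexx.
rewrite ler_distlC ler_pdivlMr// ler_pdivrMr//; apply/andP; split.
  by apply: le_trans lo; rewrite ler_pM2r//; lra.
by apply: (le_trans up); rewrite ler_pM2r//; lra.
Qed.

Lemma asymp_equiv_common f g h :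
  (exists K0 : R, forall K, K0 <= K -> 0 < h K) ->
  asymp_equiv f h -> asymp_equiv g h -> asymp_equiv f g.
Proof.
move=> [K1 h0] fh gh; rewrite /asymp_equiv.
have : (f K / h K) / (g K / h K) @[K --> +oo] --> (1 / 1 : R).
  by apply: cvgM => //; apply: cvgV.
rewrite divr1; apply: cvg_trans; apply: near_eq_cvg.
exists K1; split; first exact: num_real.
move=> K /ltW KK1 /=; have hn0 : h K != 0 by rewrite gt_eqF// h0.
by rewrite invf_div mulrA divfK.
Qed.

End asymptotic_equivalence.

(** * The asymptotics of the three ruin probabilities *)

Unset Implicit Arguments.

Theorem theorem1 (d : measure_display) (T : measurableType d) (R : realType)
    (P : probability T R) (zeta sigma : nat -> {RV P >-> R})
    (lambda mu p1 p2 a A alpha : R)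
    (zeta_ge0 : forall i w, 0 <= zeta i w)
    (sigma_ge0 : forall i w, 0 <= sigma i w)
    (zeta_iid : iid P zeta)
    (sigma_iid : iid P sigma)
    (zeta_sigma_indep : independent_sequences P zeta sigma)
    (lambda_gt0 : 0 < lambda)
    (mu_gt0 : 0 < mu)
    (zeta_mean : ('E_P[zeta 0%N] = (1 / lambda)%:E)%E)
    (sigma_mean : ('E_P[sigma 0%N] = (1 / mu)%:E)%E)
    (p1_gt : p2 < p1)
    (p2_gt : lambda / mu < p2)
    (a_gt0 : 0 < a)
    (a_lt1 : a < 1)
    (zeta_moment3 : ('E_P[fun w => (zeta 0%N w ^+ 3)%R] < +oo)%E)
    (A_gt0 : 0 < A)
    (alpha_gt1 : 1 < alpha)
    (alpha_lt2 : alpha < 2)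
    (sigma_tail : asymp_equiv (tail (sigma 0%N)) (fun x => A * x `^ (- alpha))) :
  let m1 := mean_drift P (zeta 0%N) (sigma 0%N) p1 in
  let m2 := mean_drift P (zeta 0%N) (sigma 0%N) p2 in
  let Fbar := tail (sigma 0%N) in
  let FIbar := fun x => 1 - integrated_tail mu Fbar x in
  let H := fun x1 x2 => H_integral Fbar m1 m2 x1 x2 in
  let J := fun x1 x2 => J_integral Fbar m1 m2 x1 x2 in
  let G := fun K => 1 / (m1 * mu) * FIbar (a * K) + 1 / (m2 * mu) * FIbar K
                    - H (a * K) K in
  [/\ asymp_equiv (fun K => psi_and P zeta sigma p1 p2 (a * K) K) G,
      asymp_equiv G (fun K => J (a * K) K),
      asymp_equiv (fun K => psi_or P zeta sigma p1 p2 (a * K) K)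
                  (fun K => psi_times P zeta sigma p1 p2 (a * K) K)
    & asymp_equiv (fun K => psi_times P zeta sigma p1 p2 (a * K) K)
                  (fun K => H (a * K) K)].

Proof.
move=> m1 m2 Fbar FIbar H J G.
have p2_gt0 : 0 < p2 by apply: lt_trans p2_gt; exact: divr_gt0.
have p1_gt0 : 0 < p1 by exact: lt_trans p1_gt.
have mE p : mean_drift P (zeta 0%N) (sigma 0%N) p = p * (1 / lambda) - 1 / mu.
  by rewrite /mean_drift zeta_mean sigma_mean.
pose I_min K := profile_integral Fbar (min_profile lambda mu p1 p2 a K).
pose I_max K := profile_integral Fbar (max_profile lambda mu p1 p2 a K).
have HE K : H (a * K) K = I_max K by rewrite /H /H_integral /m1 /m2 !mE.
have JE K : J (a * K) K = I_min K by rewrite /J /J_integral /m1 /m2 !mE.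
have GE (K : R) : 0 < K -> G K = I_min K.
  move=> K0; rewrite /G HE /FIbar /m1 /m2 !mE.
  exact: (min_max_integrals sigma_ge0 sigma_iid lambda_gt0 mu_gt0 sigma_mean p1_gt p2_gt).
have [Kp Ip] := profile_integral_gt0 lambda_gt0 A_gt0 alpha_gt1 sigma_tail
  p1_gt p2_gt a_gt0 a_lt1.
have up := ruin_upper zeta_ge0 sigma_ge0 zeta_iid sigma_iid lambda_gt0
  mu_gt0 zeta_mean sigma_mean zeta_moment3 A_gt0 alpha_gt1 alpha_lt2 sigma_tail
  p1_gt p2_gt a_gt0 a_lt1.
have lo := ruin_lower zeta_ge0 sigma_ge0 zeta_iid sigma_iid zeta_sigma_indep lambda_gt0
  mu_gt0 zeta_mean sigma_mean zeta_moment3 A_gt0 alpha_gt1 alpha_lt2 sigma_tail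
  p1_gt p2_gt a_gt0 a_lt1.
have both (eps : R) : 0 < eps -> eps <= 1 -> exists K0 : R, forall K : R, K0 <= K ->
  [/\ (1 - eps) * I_min K <= psi_and P zeta sigma p1 p2 (a * K) K <= (1 + eps) * I_min K,
      (1 - eps) * I_max K <= psi_or P zeta sigma p1 p2 (a * K) K <= (1 + eps) * I_max K &
      (1 - eps) * I_max K <= psi_times P zeta sigma p1 p2 (a * K) K <= (1 + eps) * I_max K].
  move=> e0 e1; have [K1 H1] := up eps e0 e1; have [K2 H2] := lo eps e0 e1.
  exists (Num.max 1 (Num.max K1 K2)) => K; rewrite !ge_max => /and3P[K1' KK1 KK2].
  have K0 : 0 < K by lra.
  have aK := mulr_gt0 a_gt0 K0.
  have [u1 u2] := H1 K KK1; have [l1 l2] := H2 K KK2.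
  rewrite psi_andE// psi_orE// psi_timesE//.
  have le := ruin_max_le_times zeta sigma p1 p2 a K.
  split; apply/andP; split => //.
  - exact: le_trans u2.
  - exact: le_trans le.
have I_min_gt0 : exists K0 : R, forall K, K0 <= K -> 0 < I_min K.
  by exists Kp => K /Ip[].
have I_max_gt0 : exists K0 : R, forall K, K0 <= K -> 0 < I_max K.
  by exists Kp => K /Ip[].
have and_equiv : asymp_equiv (fun K => psi_and P zeta sigma p1 p2 (a * K) K) I_min.
  apply: asymp_equiv_squeeze => // eps e0 e1; have [K0 HK] := both eps e0 e1.
  by exists K0 => K /HK[].
have or_equiv : asymp_equiv (fun K => psi_or P zeta sigma p1 p2 (a * K) K) I_max.
  apply: asymp_equiv_squeeze => // eps e0 e1; have [K0 HK] := both eps e0 e1.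
  by exists K0 => K /HK[].
have times_equiv : asymp_equiv (fun K => psi_times P zeta sigma p1 p2 (a * K) K) I_max.
  apply: asymp_equiv_squeeze => // eps e0 e1; have [K0 HK] := both eps e0 e1.
  by exists K0 => K /HK[].
have GI : asymp_equiv G I_min.
  have [K1 HK1] := I_min_gt0.
  apply: asymp_equiv_squeeze => // eps e0 e1; exists (Num.max 1 K1) => K.
  rewrite ge_max => /andP[K1' KK1]; rewrite GE; last by lra.
  by have := HK1 K KK1; move=> I0; apply/andP; split; nra.
have GJ : I_min = (fun K => J (a * K) K) by apply/funext => K; rewrite JE.
have HI : I_max = (fun K => H (a * K) K) by apply/funext => K; rewrite HE.
split.
- exact: (asymp_equiv_common _ and_equiv GI).
- by rewrite -GJ.
- exact: (asymp_equiv_common _ or_equiv times_equiv).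
- by rewrite -HI.
Qed.
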